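(* Let $F$ be a number field of degree $n$ and let $w=\#\mu_F$ denote the number of roots of unity in $F$. Then there is a constant $\beta$ depending only on $F$ such that $$\left|\frac{\log\left(\frac1w h^0(D)\right)}{\mathrm{covol}(I)^{2/n}}+\pi\gamma(I)\right|<\beta\,e^{2\deg(D)/n}\qquad\text{for all Arakelov divisors } D \text{ of } F \text{ with } \deg(D)<0.$$ Here $I$ denotes the ideal associated to $D$, viewed as a lattice with the metric induced by $D$, and $\gamma(I)$ denotes the Hermite constant of this lattice, i.e. the square of the length of the shortest non-zero vector in $I$ divided by $\mathrm{covol}(I)^{2/n}$.
   Context: Let $F$ be a number field with ring of integers $O_F$ and discriminant $\Delta$. The infinite primes $\sigma$ of $F$ are the $r_1$ real embeddings together with one chosen embedding from each of the $r_2$ pairs of complex conjugate embeddings. An Arakelov divisor of $F$ is a formal finite sum $D=\sum_P x_P P+\sum_\sigma x_\sigma\sigma$, with $P$ running over the nonzero prime ideals of $O_F$, $\sigma$ over the infinite primes, $x_P\in\mathbb{Z}$ (almost all zero) and $x_\sigma\in\mathbb{R}$. The degree is $\deg(D)=\sum_P \log(\#(O_F/P))\,x_P+\sum_\sigma x_\sigma$. The fractional ideal associated to $D$ is $I=\prod_P P^{-x_P}$. On $\mathbb{R}^{r_1}\times\mathbb{C}^{r_2}$ put $$\|(z_\sigma)\|_D^2=\sum_{\sigma\text{ real}}|z_\sigma|^2e^{-2x_\sigma}+\sum_{\sigma\text{ complex}}2|z_\sigma|^2e^{-x_\sigma},$$ and for $f\in F$ put $\|f\|_D=\|(\sigma(f))_\sigma\|_D$.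 Via the embeddings $\sigma$, $I$ is a lattice in the Euclidean space $(\mathbb{R}^{r_1}\times\mathbb{C}^{r_2},\|\cdot\|_D)$; lengths and $\mathrm{covol}(I)$ are taken with respect to this Euclidean structure, and $\mathrm{covol}(I)=\sqrt{|\Delta|}\,e^{-\deg(D)}$. Put $h^0(D)=\log\left(\sum_{f\in I}e^{-\pi\|f\|_D^2}\right)$. *)

(* Defs.v *)
From HB Require Import structures.
From mathcomp Require Import all_boot all_order all_algebra all_field.
From mathcomp Require Import finmap.
From mathcomp Require Import all_classical all_reals all_analysis.
From mathcomp.real_closed Require Import complex.

Set Implicit Arguments.
Unset Strict Implicit.
Unset Printing Implicit Defensive.

Import Order.TTheory GRing.Theory Num.Theory.

Local Open Scope classical_set_scope.
Local Open Scope ring_scope.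

(* A number field is a finite extension [F : fieldExtType rat]; its degree is
   [\dim {:F}]. *)

Section RingOfIntegers.
Variable F : fieldExtType rat.

Definition ring_int : {pred F} := fun x => `[< integralOver (intr : int -> F) x >].

Lemma ring_int_subring : subring_closed ring_int.
Proof.
split=> [|x y /asboolP Ix /asboolP Iy|x y /asboolP Ix /asboolP Iy]; apply/asboolP.
- exact: integral1.
- exact: integral_sub.
- exact: integral_mul.
Qed.
HB.instance Definition _ := GRing.isSubringClosed.Build F ring_int ring_int_subring.

Record OF := IntOF { intval : F; intvalP : intval \in ring_int }.
HB.instance Definition _ := [isSub for intval].
HB.instance Definition _ := [Choice of OF by <:].
HB.instance Definition _ := [SubChoice_isSubComNzRing of OF by <:].

(* [idealr_closed] contains [1 \notin P]. *)
Record finite_prime := FinitePrime {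
  fp_pred : OF -> bool;
  fp_ideal : idealr_closed fp_pred;
  fp_prime : prime_idealr_closed fp_pred;
  fp_nonzero : exists2 a, a != 0 & a \in fp_pred }.
HB.instance Definition _ := gen_eqMixin finite_prime.
HB.instance Definition _ := gen_choiceMixin finite_prime.
HB.instance Definition _ (P : finite_prime) :=
  isIdealr.Build OF (fp_pred P) (fp_ideal P).

Definition residue_card (P : finite_prime) : nat :=
  #|` fset_set [set: {ideal_quot (fp_pred P : {pred OF})}] |.

Definition ringF : set F := [set` ring_int].

Definition primeF (P : finite_prime) : set F := intval @` [set` fp_pred P].

Definition fideal_mul (I J : set F) : set F :=
  [set x | exists s : seq (F * F),
     (forall u, u \in s -> I u.1 /\ J u.2) /\ x = \sum_(u <- s) u.1 * u.2].

Definition fideal_inv (I : set F) : set F :=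
  [set x | forall y, I y -> ringF (x * y)].

Definition fideal_pow (I : set F) (k : int) : set F :=
  match k with
  | Posz m => iter m (fideal_mul I) ringF
  | Negz m => iter m.+1 (fideal_mul (fideal_inv I)) ringF
  end.

Definition num_roots_unity : nat :=
  #|` fset_set [set z : F | exists m, z ^+ m.+1 = 1] |.

End RingOfIntegers.

Section Arakelov.
Variables (R : realType) (F : fieldExtType rat).

(* The complex embeddings are those whose image is not contained in [R]; one is
   chosen from each conjugate pair. *)
Record infinite_primes := InfinitePrimes {
  r1 : nat;
  r2 : nat;
  real_emb : 'I_r1 -> {rmorphism F -> R};
  cplx_emb : 'I_r2 -> {rmorphism F -> R[i]};
  real_emb_inj : forall i j, real_emb i =1 real_emb j -> i = j;
  real_emb_surj : forall s : {rmorphism F -> R}, exists i, s =1 real_emb i;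
  cplx_emb_nonreal : forall j, exists x, complex.Im (cplx_emb j x) != 0;
  cplx_emb_inj : forall i j,
    cplx_emb i =1 cplx_emb j \/ cplx_emb i =1 conjc \o cplx_emb j -> i = j;
  cplx_emb_surj : forall s : {rmorphism F -> R[i]},
    (exists x, complex.Im (s x) != 0) ->
    exists j, s =1 cplx_emb j \/ s =1 conjc \o cplx_emb j }.

Variable S : infinite_primes.

Record arakelov_divisor := ArakelovDivisor {
  coef_fin : {fsfun finite_prime F -> int with 0};
  coef_real : 'I_(r1 S) -> R;
  coef_cplx : 'I_(r2 S) -> R }.

Definition mink_space : zmodType := ('rV[R]_(r1 S) * 'rV[R[i]]_(r2 S))%type.

Definition mink_emb (f : F) : mink_space :=
  (\row_i real_emb i f, \row_j cplx_emb j f).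

Variable D : arakelov_divisor.

Definition adeg : R :=
  \sum_(P <- finsupp (coef_fin D)) ln (residue_card P)%:R * (coef_fin D P)%:~R
  + \sum_i coef_real D i + \sum_j coef_cplx D j.

Definition aideal : set F :=
  \big[@fideal_mul F / @ringF F]_(P <- finsupp (coef_fin D))
    fideal_pow (primeF P) (- coef_fin D P).

Definition normsq (z : mink_space) : R :=
  \sum_i `|z.1 ord0 i| ^+ 2 * expR (- 2 * coef_real D i)
  + \sum_j 2 * complex.ComplexField.Normc.normc (z.2 ord0 j) ^+ 2
      * expR (- coef_cplx D j).

Definition h0 : R :=
  ln (fine (\esum_(f in aideal) (expR (- pi * normsq (mink_emb f)))%:E)).

Definition alattice : set mink_space := mink_emb @` aideal.

End Arakelov.

(* Lattices in a real space [V] with the Euclidean structure whose squared norm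
   is [q]. *)
Section Lattice.
Variables (R : realType) (V : zmodType) (q : V -> R) (L : set V).

Definition inner (u v : V) : R := (q (u + v) - q u - q v) / 2.

Definition zbasis m (b : 'I_m -> V) : Prop :=
  let comb (k : {ffun 'I_m -> int}) := \sum_i b i *~ k i in
  L = range comb /\ injective comb.

(* The square root of the Gram determinant is the same for all Z-bases. *)
Definition covol : R :=
  xget 0 [set c | exists m (b : 'I_m -> V),
    zbasis b /\ c = Num.sqrt (\det (\matrix_(i, j) inner (b i) (b j)))].

Definition shortest_vector (v : V) : Prop :=
  [/\ L v, v != 0 & forall u, L u -> u != 0 -> Num.sqrt (q v) <= Num.sqrt (q u)].

Definition min_length : R :=
  xget 0 [set Num.sqrt (q v) | v in shortest_vector].

(* [n] is the rank of the lattice. *)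
Definition hermite (n : nat) : R := min_length ^+ 2 / covol `^ (2 / n%:R).

End Lattice.

(* Main.v *)
(** Multiplying through by [covol(I)^(2/n)], which is [e^(-2 deg(D)/n)] up to a constant,
  the claim says that [log(h0(D)/w) + pi lambda^2] is bounded, [lambda] being the
  length of a shortest vector of [I].  Since only bounds up to constants of [F] are
  needed, [covol(I)] is merely bounded below and [w] is merely a positive constant.

  Write [I = A B^-1] with [A], [B] products of primes.  Comparing indices of lattices
  in [O_F] gives [|N(f)| >= c N(A)/N(B)] for nonzero [f] in [I], and the same bound for
  the determinant of a Z-basis of [I]; this rests on the invertibility of primes and
  on [#(J/PJ) = #(O/P)].  By the inequality between arithmetic and geometric means,
  [lambda] is bounded below when [deg(D) < 0].  A packing argument then bounds the sum
  of [e^(-pi |f|^2)] over nonzero [f] in [I] by a constant times [e^(-pi lambda^2)],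
  and it is at least [e^(-pi lambda^2)].  *)
Require Import Defs.
From HB Require Import structures.
From mathcomp Require Import all_boot all_order all_algebra all_field.
From mathcomp Require Import finmap.
From mathcomp Require Import all_classical all_reals all_analysis.
From mathcomp.real_closed Require Import complex.
From mathcomp Require Import zify ring lra.

Set Implicit Arguments.
Unset Strict Implicit.
Unset Printing Implicit Defensive.

Import Order.TTheory GRing.Theory Num.Theory.

Local Open Scope classical_set_scope.
Local Open Scope ring_scope.

(** * Integral bases and multiplication matrices *)

(** [O_F] is never given a Z-basis. It is squeezed between [Zb] and [d^-1 Zb], where [b] is a
    Q-basis of integral elements and [d] is the absolute value of the determinant of its trace form.
    Each passage between [O_F] and [Zb] costs a factor [d^n], and two passages give the [d^(2n)]
    found in all lower bounds. In the same spirit an index is split into an upper bound [index_le]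
    and a lower bound [index_ge]. Only [N(A)] from below and [N(B)] from above matter, so the
    inclusion of [I B] in [A] takes the place of the equality [I = A B^-1].

    The double logarithm asks for more than a bound on the theta sum: [theta - 1] must be comparable
    to [t = e^(-pi lambda^2)], uniformly although [lambda] can be arbitrarily large and [t]
    arbitrarily small. For this reason the packing is done at the scale of the shortest vector
    itself.

    The constant [beta] is chosen before the infinite primes are, so every constant must depend only
    on [n], [b], [d] and [w]. *)

Lemma ring_intP (F : fieldExtType rat) (x : F) :
  reflect (integralOver (intr : int -> F) x) (x \in @ring_int F).
Proof. exact: asboolP. Qed.

(** The determinant trick: an eigenvalue of an integer matrix is a root of its characteristic
    polynomial, which is monic with integer coefficients. *)
Lemma ring_int_eigen (F : fieldExtType rat) k (A : 'M[int]_k) (y : 'rV[F]_k) x :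
  y != 0 -> y *m map_mx intr A = x *: y -> x \in @ring_int F.
Proof.
move=> y0 yA; apply/ring_intP; exists (char_poly A); first exact: char_poly_monic.
rewrite map_char_poly -eigenvalue_root_char; apply/eigenvalueP; exists y => //.
Qed.

Lemma ratr_algC_int (r : rat) : (ratr r : algC) \in Aint -> exists a : int, r = a%:~R.
Proof.
move=> rA; have /intrP [a ra] : (ratr r : algC) \is a Num.int.
  exact: Cint_rat_Aint (Crat_rat r) rA.
exists a; apply: (fmorph_inj (@ratr algC)).
by rewrite rmorph_int; exact: ra.
Qed.

Lemma mx_eq0_comp_free (K : fieldType) (n m : nat) (A : 'M[K]_(n, m)) :
  (forall c : 'rV_n, c *m A = 0) -> A = 0.
Proof. by move=> h; apply/row_matrixP => i; rewrite rowE h row0. Qed.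

(** Over [algC] the trace is the sum of the roots of the characteristic polynomial. These are roots
    of the minimal polynomial, hence of [p], hence algebraic integers, and a rational algebraic
    integer is an integer. *)
Lemma trace_int (k : nat) (M : 'M[rat]_k.+1) (p : {poly int}) :
  p \is monic -> horner_mx M (map_poly intr p) = 0 -> exists a : int, \tr M = a%:~R.
Proof.
move=> pm pM; apply: ratr_algC_int.
pose A : 'M[algC]_k.+1 := map_mx ratr M.
have -> : (ratr (\tr M) : algC) = \tr A by rewrite trace_map_mx.
have [r Dr] := closed_field_poly_normal (char_poly A).
rewrite (monicP (char_poly_monic A)) scale1r in Dr.
have sr : size r = k.+1.
  by apply: succn_inj; rewrite -(size_char_poly A) Dr (size_prod_XsubC _ id).
have := char_poly_trace A (ltn0Sn k).
rewrite Dr -[X in X.-1]sr coefPn_prod_XsubC ?sr // => /oppr_inj <-.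
rewrite big_seq rpred_sum // => z zr.
apply: (@root_monic_Aint (map_poly intr p)).
- have rz : root (mxminpoly A) z.
    by rewrite root_mxminpoly Dr root_prod_XsubC.
  apply: root_dvdp rz; apply: mxminpoly_min.
  have := congr1 (map_mx (@ratr algC)) pM; rewrite map_horner_mx map_mx0 => h.
  rewrite -[RHS]h; congr horner_mx; rewrite -map_poly_comp.
  by apply: eq_map_poly => a /=; rewrite rmorph_int.
- exact: monic_map.
- by apply/polyOverP => i; rewrite coef_map /= intr_int.
Qed.

Lemma common_denominator (T : finType) (f : T -> rat) :
  exists2 m : nat, (0 < m)%N & exists g : T -> int, forall t, m%:R * f t = (g t)%:~R.
Proof.
exists (\prod_t `|denq (f t)|)%N.
  by rewrite prodn_gt0 // => t; rewrite absz_gt0 denq_neq0.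
exists (fun t => (\prod_(u | u != t) `|denq (f u)|)%N%:Z * numq (f t)) => t.
rewrite (bigD1 t) //= natrM rmorphM /= [_%:R * _]mulrC -mulrA; congr (_ * _).
rewrite natr_absz gtr0_norm ?denq_gt0 // -{2}[f t]divq_num_den mulrC divfK //.
by rewrite intr_eq0 denq_neq0.
Qed.

Section Coordinates.
Variables (F : fieldExtType rat) (n : nat) (b : n.+1.-tuple F).
Hypothesis basis_b : basis_of fullv b.

Definition vec_of (c : 'rV[rat]_n.+1) : F := \sum_i c 0 i *: b`_i.
Definition coords (x : F) : 'rV[rat]_n.+1 := \row_i coord b i x.
Definition mul_mx (x : F) : 'M[rat]_n.+1 := \matrix_i coords (b`_i * x).

Lemma coordsK x : vec_of (coords x) = x.
Proof.
rewrite {2}(coord_basis basis_b (memvf x)); apply: eq_bigr => i _.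
by rewrite mxE.
Qed.

Lemma vec_ofK c : coords (vec_of c) = c.
Proof.
by apply/rowP => i; rewrite mxE coord_sum_free // (basis_free basis_b).
Qed.

Lemma vec_of_is_linear : linear vec_of.
Proof.
move=> a u v; rewrite /vec_of scaler_sumr -big_split /=; apply: eq_bigr => i _.
by rewrite !mxE scalerDl scalerA.
Qed.
HB.instance Definition _ := GRing.isLinear.Build rat 'rV[rat]_n.+1 F _ vec_of vec_of_is_linear.

Lemma coords_is_linear : linear coords.
Proof. by move=> a u v; apply/rowP => i; rewrite !mxE linearP. Qed.
HB.instance Definition _ := GRing.isLinear.Build rat F 'rV[rat]_n.+1 _ coords coords_is_linear.

Lemma vec_of_delta i : vec_of (delta_mx 0 i) = b`_i.
Proof.
rewrite /vec_of (bigD1 i) //= big1 ?addr0 ?mxE ?eqxx ?scale1r // => j ji.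
by rewrite mxE (negPf ji) andbF scale0r.
Qed.

Lemma vec_of_mul c x : vec_of (c *m mul_mx x) = vec_of c * x.
Proof.
rewrite mulmx_sum_row linear_sum /= [vec_of c]/vec_of mulr_suml.
by apply: eq_bigr => i _; rewrite linearZ /= rowK coordsK scalerAl.
Qed.

(** A matrix is determined by its action on coordinates; the ring identities for [mul_mx] below all
    follow from this. *)
Lemma mul_mx_unique x (A : 'M[rat]_n.+1) :
  (forall c, vec_of (c *m A) = vec_of c * x) -> A = mul_mx x.
Proof.
move=> h; apply/eqP; rewrite -subr_eq0; apply/eqP; apply: mx_eq0_comp_free => c.
rewrite mulmxBr; apply/eqP; rewrite subr_eq0; apply/eqP.
by rewrite -[LHS]vec_ofK -[RHS]vec_ofK h vec_of_mul.
Qed.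

Lemma mul_mxD x y : mul_mx (x + y) = mul_mx x + mul_mx y.
Proof.
by apply/esym/mul_mx_unique => c; rewrite mulmxDr linearD /= !vec_of_mul mulrDr.
Qed.

Lemma mul_mxM x y : mul_mx (x * y) = mul_mx x *m mul_mx y.
Proof.
by apply/esym/mul_mx_unique => c; rewrite mulmxA !vec_of_mul mulrA.
Qed.

Lemma mul_mxZ a x : mul_mx (a *: x) = a *: mul_mx x.
Proof.
by apply/esym/mul_mx_unique => c; rewrite -scalemxAr linearZ /= vec_of_mul scalerAr.
Qed.

Lemma mul_mx1 : mul_mx 1 = 1%:M.
Proof. by apply/esym/mul_mx_unique => c; rewrite mulmx1 mulr1. Qed.

Lemma horner_mul_mx (p : {poly int}) x :
  horner_mx (mul_mx x) (map_poly intr p) = mul_mx (map_poly intr p).[x].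
Proof.
elim/poly_ind: p => [|p c IH].
  rewrite !rmorph0 horner0; apply: mul_mx_unique => d.
  by rewrite mulmx0 raddf0 mulr0.
rewrite !(rmorphD, rmorphM) /= !map_polyX !map_polyC /= hornerMXaddC.
rewrite horner_mx_X horner_mx_C IH mul_mxD mul_mxM; congr (_ + _).
have -> : (c%:~R : F) = (c%:~R : rat) *: 1 by rewrite scaler_int.
by rewrite mul_mxZ mul_mx1 scalemx1.
Qed.

Lemma trace_mul_mx_int x : x \in @ring_int F -> exists a : int, \tr (mul_mx x) = a%:~R.
Proof.
move=> /ring_intP [p pm /rootP px]; apply: (@trace_int _ _ p) => //.
rewrite horner_mul_mx px; apply/esym/mul_mx_unique => c.
by rewrite mulmx0 linear0 mulr0.
Qed.

Lemma mul_mx_unit x : x != 0 -> mul_mx x \in unitmx.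
Proof.
move=> x0; have := mul_mxM x x^-1; rewrite divff // mul_mx1 => /esym/mulmx1_unit.
by case.
Qed.

Lemma ring_int_scale x : exists2 m : nat, (0 < m)%N & m%:R * x \in @ring_int F.
Proof.
have [m m0 [g hg]] :=
  common_denominator (fun t : 'I_n.+1 * 'I_n.+1 => mul_mx x t.2 t.1).
exists m => //.
(* [A] is the transpose of [m] times [mul_mx x], because here the basis itself is the row
   eigenvector. *)
pose A : 'M[int]_n.+1 := \matrix_(i, j) g (i, j).
apply: (@ring_int_eigen _ _ A (\row_i b`_i)).
  apply/eqP => /rowP h.
  have b0 (i : 'I_n.+1) : b`_i = 0 by move: (h i); rewrite !mxE.
  have : (1 : F) = 0.
    by rewrite -(coordsK 1) /vec_of big1 // => i _; rewrite b0 scaler0.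
  by apply/eqP; exact: oner_neq0.
apply/rowP => j; rewrite !mxE -mulrA [x * _]mulrC.
have /(congr1 (fun z => m%:R * z)) := vec_of_mul (delta_mx 0 j) x.
rewrite vec_of_delta => <-; rewrite -rowE /vec_of mulr_sumr.
apply: eq_bigr => i _; have /= hij := hg (i, j); rewrite !mxE in hij *.
by rewrite mulr_natl -scaler_nat scalerA hij scaler_int mulrzr.
Qed.

Definition trace_mx : 'M[rat]_n.+1 := \matrix_(i, j) \tr (mul_mx (b`_i * b`_j)).

Lemma trace_mxE c (j : 'I_n.+1) : (c *m trace_mx) 0 j = \tr (mul_mx (vec_of c * b`_j)).
Proof.
rewrite /vec_of mulr_suml mxE.
have -> : mul_mx (\sum_i c 0 i *: b`_i * b`_j) = \sum_i c 0 i *: mul_mx (b`_i * b`_j).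
  have m0 : mul_mx 0 = 0 by rewrite -[0](scale0r 1) mul_mxZ scale0r.
  rewrite (big_morph _ mul_mxD m0); apply: eq_bigr => i _.
  by rewrite -scalerAl mul_mxZ.
by rewrite linear_sum; apply: eq_bigr => i _; rewrite linearZ /= mxE.
Qed.

(** Nondegeneracy of the trace form: a kernel vector would give [y != 0] with [tr(y z) = 0] for all
    [z], but [z = y^-1] has trace [n+1], nonzero in characteristic 0. *)
Lemma det_trace_mx : \det trace_mx != 0.
Proof.
apply/negP => /det0P [c c0 cT].
have y0 : vec_of c != 0.
  by apply: contraNneq c0 => y0; rewrite -[c]vec_ofK y0 linear0.
have tr0 z : \tr (mul_mx (vec_of c * z)) = 0.
  rewrite -(coordsK z) {2}/vec_of mulr_sumr.
  have m0 : mul_mx 0 = 0 by rewrite -[0](scale0r 1) mul_mxZ scale0r.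
  rewrite (big_morph _ mul_mxD m0) linear_sum /= big1 // => i _.
  by rewrite -scalerAr mul_mxZ mxtraceZ -trace_mxE cT !mxE mulr0.
have := tr0 (vec_of c)^-1; rewrite divff // mul_mx1 mxtrace1 => /eqP.
by rewrite pnatr_eq0.
Qed.

Definition int_vec (k : 'rV[int]_n.+1) : F := vec_of (map_mx intr k).

Hypothesis integral_b : forall i : 'I_n.+1, b`_i \in @ring_int F.

Lemma int_vec_ring_int k : int_vec k \in @ring_int F.
Proof.
rewrite /int_vec /vec_of rpred_sum // => i _.
by rewrite mxE scaler_int rpredMz // integral_b.
Qed.

Lemma trace_mx_int : exists T : 'M[int]_n.+1, trace_mx = map_mx intr T.
Proof.
have /choice [T hT] : forall ij : 'I_n.+1 * 'I_n.+1,
    exists a : int, trace_mx ij.1 ij.2 = a%:~R.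
  move=> [i j]; rewrite mxE; apply: trace_mul_mx_int.
  by rewrite rpredM ?integral_b.
exists (\matrix_(i, j) T (i, j)); apply/matrixP => i j.
by rewrite [RHS]mxE [X in X%:~R]mxE; exact: (hT (i, j)).
Qed.

(** The traces of [x b_j] are integers and form the vector [coords x] times the integer trace matrix
    [T]. Multiplying by the adjugate of [T] shows that [det T] clears the denominators of
    [coords x]. *)
Lemma ring_int_sub_lattice : exists2 d : nat, (0 < d)%N &
  forall x, x \in @ring_int F -> exists k, d%:R * x = int_vec k.
Proof.
have [T hT] := trace_mx_int.
have T0 : \det T != 0 by have := det_trace_mx; rewrite hT det_map_mx intr_eq0.
exists `|\det T|%N; first by rewrite absz_gt0.
suff h x : x \in @ring_int F -> exists k, (\det T)%:~R * x = int_vec k.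
  move=> x /h [k hk].
  have -> : (`|\det T|%N%:R : F) = `|\det T|%:~R by rewrite pmulrn abszE.
  have [] : `|\det T| = \det T \/ `|\det T| = - \det T by case: ger0P; [left|right].
    by move=> ->; exists k.
  move=> ->; exists (- k); rewrite rmorphN mulNr hk /int_vec.
  by rewrite -linearN; congr vec_of; apply/rowP => i; rewrite !mxE rmorphN.
move=> xO.
have /choice [k hk] : forall j : 'I_n.+1, exists a : int,
    \tr (mul_mx (x * b`_j)) = a%:~R.
  by move=> j; apply: trace_mul_mx_int; rewrite rpredM ?integral_b.
exists ((\row_j k j) *m \adj T).
rewrite /int_vec map_mxM /= -(coordsK x).
have -> : map_mx intr (\row_j k j) = coords x *m map_mx intr T :> 'rV[rat]__.
  by apply/rowP => j; rewrite -hT trace_mxE coordsK hk !mxE.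
rewrite -mulmxA -map_mxM mul_mx_adj map_scalar_mx mul_mx_scalar linearZ /=.
by rewrite scaler_int mulrzl.
Qed.
End Coordinates.

(** A Q-basis consisting of integral elements, obtained by scaling; its Z-span may be smaller than
    [O_F]. *)
Lemma exists_integral_basis (F : fieldExtType rat) : exists n, \dim {:F} = n.+1 /\
  exists2 b : n.+1.-tuple F, basis_of fullv b & forall i : 'I_n.+1, b`_i \in @ring_int F.
Proof.
have := vbasisP {:F}; set B := vbasis _.
have := adim_gt0 {:F}%AS; move: B; case: (\dim {:F}) => [//|n] B _ basB.
exists n; split=> //.
have /choice [m hm] : forall i : 'I_n.+1, exists m : nat,
    (0 < m)%N /\ m%:R * B`_i \in @ring_int F.
  by move=> i; have [m ? ?] := ring_int_scale basB B`_i; exists m.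
pose M := (\prod_i m i)%N.
have M0 : (M%:R : rat) != 0.
  by rewrite pnatr_eq0 -lt0n prodn_gt0 // => i; case: (hm i).
have nthE (i : 'I_n.+1) : [seq M%:R *: v | v <- B]`_i = M%:R *: B`_i.
  by rewrite (nth_map 0) ?size_tuple.
exists [tuple of [seq (M%:R : rat) *: v | v <- B]].
  rewrite basisEfree; apply/and3P; split; rewrite ?subvf //; last first.
    by rewrite size_tuple (size_basis basB).
  apply/freeP => k hk i.
  apply: (mulIf M0); rewrite mul0r.
  have /freeP h := basis_free basB.
  apply: (h (fun i => k i * M%:R)); rewrite -[RHS]hk.
  by apply: eq_bigr => j _; rewrite nthE scalerA.
move=> i; rewrite nthE scaler_nat -mulr_natl /M (bigD1 i) //= mulnC natrM -mulrA.
by rewrite rpredM ?rpred_nat //; case: (hm i).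
Qed.

(** * Indices and invertibility of prime ideals *)

Section Index.
Variable V : zmodType.
Implicit Types (J K L : set V) (N M : nat).

Definition subgroup J := J 0 /\ forall x y, J x -> J y -> J (x - y).

(** One-sided indices that make sense without [J] being contained in [K]. The representatives in
    [index_le] may lie outside [K], so the bound survives shrinking [K] and enlarging [J]. *)
Definition index_le K J N :=
  exists2 s : seq V, (size s <= N)%N & forall x, K x -> exists2 y, y \in s & J (x - y).

Definition index_ge K J N := exists s : seq V,
  [/\ size s = N, uniq s, {in s, forall x, K x} & {in s &, forall x y, J (x - y) -> x = y}].

Lemma subgroup_opp J x : subgroup J -> J x -> J (- x).
Proof. by move=> [J0 JB] Jx; rewrite -sub0r; apply: JB. Qed.

Lemma subgroup_add J x y : subgroup J -> J x -> J y -> J (x + y).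
Proof. by move=> sJ Jx Jy; rewrite -(opprK y); apply: sJ.2 => //; apply: subgroup_opp. Qed.

Lemma index_le_trans K J L N M :
  index_le K J N -> index_le J L M -> index_le K L (N * M).
Proof.
move=> [s ss hs] [t st ht]; exists [seq y + z | y <- s, z <- t].
  by rewrite size_allpairs leq_mul.
move=> x /hs [y ys /ht [z zt Lz]]; exists (y + z); first exact: allpairs_f.
by rewrite opprD addrA.
Qed.

Lemma index_ge_trans K J L N M : subgroup K -> J `<=` K -> subgroup J -> L 0 -> L `<=` J ->
  index_ge K J N -> index_ge J L M -> index_ge K L (N * M).
Proof.
move=> sK JK sJ L0 LJ [s [ss us sK' hs]] [t [st ut tJ ht]].
have inj y y' z z' : y \in s -> y' \in s -> z \in t -> z' \in t ->
    L (y + z - (y' + z')) -> y = y' /\ z = z'.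
  move=> ys ys' zt zt' Lyz.
  have yy' : y = y'.
    apply: hs => //; have -> : y - y' = (y + z - (y' + z')) - (z - z').
      by rewrite opprD addrACA addrK.
    by apply: sJ.2; [exact: LJ | apply: sJ.2; apply: tJ].
  split=> //; apply: ht => //; move: Lyz.
  by rewrite yy' opprD addrACA subrr add0r.
exists [seq y + z | y <- s, z <- t]; split.
- by rewrite size_allpairs ss st.
- apply: allpairs_uniq => // -[y z] [y' z'] /allpairsP [[a b] /= [a1 b1 [-> ->]]].
  move=> /allpairsP [[a' b'] /= [a1' b1' [-> ->]]] /= e.
  have [] := inj a a' b b' a1 a1' b1 b1'; last by move=> -> ->.
  by rewrite e subrr.
- move=> x /allpairsP [[a b] /= [a1 b1 ->]].
  by apply: subgroup_add => //; [exact: sK' | apply: JK; exact: tJ].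
- move=> x y /allpairsP [[a b] /= [a1 b1 ->]] /allpairsP [[a' b'] /= [a1' b1' ->]].
  by move=> /(inj _ _ _ _ a1 a1' b1 b1') [-> ->].
Qed.

(** Pigeonhole: sending an element to the first representative of its coset is injective on
    inequivalent elements. *)
Lemma index_ge_le K J N M : subgroup J ->
  index_ge K J N -> index_le K J M -> (N <= M)%N.
Proof.
move=> sJ [s [ss us sK hs]] [t st ht].
pose f x := find (fun y => `[< J (x - y) >]) t.
have fP x : x \in s -> (f x < size t)%N /\ J (x - nth 0 t (f x)).
  move=> /sK /ht [y yt Jy].
  have h : has (fun y => `[< J (x - y) >]) t by apply/hasP; exists y => //; apply/asboolP.
  by split; [rewrite -has_find | apply/asboolP; exact: (nth_find 0 h)].
rewrite -ss -(size_map f s); apply: leq_trans st; rewrite -[X in (_ <= X)%N](size_iota 0).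
apply: uniq_leq_size.
  rewrite map_inj_in_uniq // => x y xs ys fxy; apply: hs => //.
  have [_ Jx] := fP x xs; have [_ Jy] := fP y ys; rewrite -fxy in Jy.
  by have := sJ.2 _ _ Jx Jy; rewrite opprB addrA subrK.
by move=> k /mapP [x xs ->]; rewrite mem_iota /=; case: (fP x xs).
Qed.

Lemma index_leS K K' J J' N N' : K' `<=` K -> J `<=` J' -> (N <= N')%N ->
  index_le K J N -> index_le K' J' N'.
Proof.
move=> KK JJ NN [s ss hs]; exists s; first exact: leq_trans NN.
by move=> x /KK /hs [y ys /JJ Jy]; exists y.
Qed.

Lemma index_geS K K' J J' N : K `<=` K' -> J' `<=` J ->
  index_ge K J N -> index_ge K' J' N.
Proof.
move=> KK JJ [s [ss us sK hs]]; exists s; split=> // [x xs|x y xs ys /JJ]; last exact: hs.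
exact/KK/sK.
Qed.

End Index.

Lemma index_le_image (U V : zmodType) (h : {additive U -> V}) K J N :
  index_le K J N -> index_le (h @` K) (h @` J) N.
Proof.
move=> [s ss hs]; exists (map h s); first by rewrite size_map.
move=> _ [x /hs [y ys Jy] <-]; exists (h y); first exact: map_f.
by exists (x - y) => //; rewrite raddfB.
Qed.

Lemma index_ge_image (U V : zmodType) (h : {additive U -> V}) K J N : injective h ->
  index_ge K J N -> index_ge (h @` K) (h @` J) N.
Proof.
move=> hI [s [ss us sK hs]]; exists (map h s); split.
- by rewrite size_map.
- by rewrite map_inj_uniq.
- by move=> _ /mapP [x xs ->]; exists x => //; exact: sK.
- move=> _ _ /mapP [x xs ->] /mapP [y ys ->] [z Jz].
  by rewrite -raddfB => /hI ez; have -> // : x = y by apply: hs => //; rewrite -ez.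
Qed.

(** * Fractional ideals and invertibility of nonzero primes *)

Section FractionalIdeals.
Variable F : fieldExtType rat.
Local Notation O := (@ringF F).
Implicit Types I J K L P : set F.

Definition frac_ideal J :=
  subgroup J /\ forall a x, O a -> J x -> J (a * x).

Definition prime_ideal P := [/\ frac_ideal P, P `<=` O, ~ P 1,
  forall a b, O a -> O b -> P (a * b) -> P a \/ P b & exists2 a, a != 0 & P a].

Lemma ringF1 : O 1. Proof. exact: rpred1. Qed.
Lemma ringFM x y : O x -> O y -> O (x * y). Proof. exact: rpredM. Qed.
Lemma ringFB x y : O x -> O y -> O (x - y). Proof. exact: rpredB. Qed.
Lemma ringFX x k : O x -> O (x ^+ k). Proof. by move=> Ox; apply: rpredX. Qed.

Lemma frac_ideal_ringF : frac_ideal O.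
Proof.
split; [split; [exact: rpred0 | exact: ringFB] | exact: ringFM].
Qed.

Lemma fideal_mul_mem I J x y : I x -> J y -> fideal_mul I J (x * y).
Proof.
move=> Ix Jy; exists [:: (x, y)]; split; last by rewrite big_seq1.
by move=> u; rewrite inE => /eqP ->.
Qed.

Lemma fideal_mul_sub I J K : subgroup K ->
  (forall x y, I x -> J y -> K (x * y)) -> fideal_mul I J `<=` K.
Proof.
move=> sK h _ [s [hs ->]]; elim: s hs => [|u s IH] hs.
  by rewrite big_nil; exact: sK.1.
rewrite big_cons; apply: subgroup_add => //.
  by have [] := hs u (mem_head _ _); exact: h.
by apply: IH => v vs; apply: hs; rewrite inE vs orbT.
Qed.

Lemma frac_ideal_mul I J : frac_ideal I -> frac_ideal (fideal_mul I J).
Proof.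
move=> fI; have mulP a x : O a -> fideal_mul I J x -> fideal_mul I J (a * x).
  move=> Oa [s [hs ->]]; exists [seq (a * u.1, u.2) | u <- s]; split.
    by move=> _ /mapP [u /hs [Iu Ju] ->]; split=> //; exact: fI.2.
  by rewrite big_map mulr_sumr; apply: eq_bigr => u _; rewrite mulrA.
split=> //; split.
  by exists [::]; split=> //; rewrite big_nil.
move=> x y Jx Jy.
have : fideal_mul I J (- y).
  by rewrite -mulN1r; apply: mulP => //; rewrite /ringF /mkset rpredN rpred1.
move: Jx => [s [hs ->]] [t [ht ->]]; exists (s ++ t); split; last by rewrite big_cat.
by move=> u; rewrite mem_cat => /orP [/hs|/ht].
Qed.

Lemma fideal_mulC I J : fideal_mul I J = fideal_mul J I.
Proof.
apply/seteqP; split=> [] _ [s [hs ->]]; exists [seq (u.2, u.1) | u <- s].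
  split; last by rewrite big_map; apply: eq_bigr => u _; rewrite mulrC.
  by move=> _ /mapP [u /hs [? ?] ->].
split; last by rewrite big_map; apply: eq_bigr => u _; rewrite mulrC.
by move=> _ /mapP [u /hs [? ?] ->].
Qed.

Lemma fideal_mulA I J K : frac_ideal I -> frac_ideal J -> frac_ideal K ->
  fideal_mul I (fideal_mul J K) = fideal_mul (fideal_mul I J) K.
Proof.
move=> fI fJ fK.
have sub I' J' K' : frac_ideal I' -> frac_ideal J' -> frac_ideal K' ->
    fideal_mul I' (fideal_mul J' K') `<=` fideal_mul (fideal_mul I' J') K'.
  move=> fI' fJ' fK'; apply: fideal_mul_sub; first exact: (frac_ideal_mul _ (frac_ideal_mul _ fI')).1.
  move=> x _ Ix [s [hs ->]]; exists [seq (x * u.1, u.2) | u <- s]; split.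
    by move=> _ /mapP [u /hs [Iu Ju] ->]; split=> //=; exact: fideal_mul_mem.
  by rewrite big_map mulr_sumr; apply: eq_bigr => u _; rewrite mulrA.
apply/seteqP; split; first exact: sub.
(* The other inclusion is the same one for [K], [J], [I], read backwards by commutativity. *)
by rewrite fideal_mulC [fideal_mul I J]fideal_mulC [X in _ `<=` X]fideal_mulC
   [X in _ `<=` fideal_mul X _]fideal_mulC; exact: sub.
Qed.

Lemma fideal_mul1 J : frac_ideal J -> fideal_mul O J = J.
Proof.
move=> fJ; apply/seteqP; split; first exact: fideal_mul_sub fJ.1 fJ.2.
by move=> x Jx; rewrite -[x]mul1r; apply: fideal_mul_mem => //; exact: ringF1.
Qed.

Lemma fideal_mulS I I' J J' : I `<=` I' -> J `<=` J' ->
  fideal_mul I J `<=` fideal_mul I' J'.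
Proof.
move=> II JJ _ [s [hs ->]]; exists s; split=> // u /hs [? ?].
by split; [exact: II | exact: JJ].
Qed.

Lemma frac_ideal_inv I : frac_ideal (fideal_inv I).
Proof.
split; first split.
- by move=> y _; rewrite mul0r; exact: rpred0.
- by move=> x y hx hy z Iz; rewrite mulrBl; apply: ringFB; [exact: hx | exact: hy].
- by move=> a x Oa hx z Iz; rewrite -mulrA; apply: ringFM => //; exact: hx.
Qed.

Lemma frac_ideal_span J a : frac_ideal J ->
  frac_ideal [set x | exists2 u, J u & exists2 r, O r & x = u + r * a].
Proof.
move=> fJ; split; first split.
- exists 0; first exact: fJ.1.1.
  by exists 0; [exact: rpred0 | rewrite mul0r addr0].
- move=> _ _ [u Ju [r Or ->]] [v Jv [t Ot ->]].
  exists (u - v); first exact: fJ.1.2.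
  by exists (r - t); [exact: ringFB | rewrite mulrBl opprD addrACA].
- move=> b _ Ob [u Ju [r Or ->]]; exists (b * u); first exact: fJ.2.
  by exists (b * r); [exact: ringFM | rewrite mulrDr mulrA].
Qed.

(** The two properties of [O_F] from which invertibility of primes is derived. Finite quotients
    stand in for the Noetherian property and for dimension one; the next definition is the form in
    which integral closedness is used. *)
Definition residually_finite :=
  forall J, frac_ideal J -> J `<=` O -> (exists2 a, a != 0 & J a) -> exists N, index_le O J N.
Definition stabilizer_integral :=
  forall J x, frac_ideal J -> J `<=` O -> (exists2 a, a != 0 & J a) ->
    (forall y, J y -> J (x * y)) -> O x.

Hypothesis finO : residually_finite.
Hypothesis closedO : stabilizer_integral.

Definition prime_product (ps : seq (set F)) : set F := foldr (@fideal_mul F) O ps.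

Lemma prime_product_frac ps : (forall P, P \in ps -> prime_ideal P) ->
  frac_ideal (prime_product ps).
Proof.
elim: ps => [|P ps IH] hps; first exact: frac_ideal_ringF.
by apply: frac_ideal_mul; have [] := hps P (mem_head _ _).
Qed.

Lemma prime_product_sub ps : (forall P, P \in ps -> prime_ideal P) ->
  prime_product ps `<=` O.
Proof.
elim: ps => [|P ps IH] hps; first by move=> x.
have [fP PO _ _ _] := hps P (mem_head _ _).
apply: (fideal_mul_sub frac_ideal_ringF.1) => x y /PO Ox /IH Oy; apply: ringFM => //.
by apply: Oy => Q Qps; apply: hps; rewrite inE Qps orbT.
Qed.

Lemma prime_product_cat ps qs : (forall P, P \in ps ++ qs -> prime_ideal P) ->
  prime_product (ps ++ qs) = fideal_mul (prime_product ps) (prime_product qs).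
Proof.
elim: ps => [|P ps IH] hps /=.
  by rewrite fideal_mul1 //; apply: prime_product_frac.
rewrite IH; last by move=> Q Qps; apply: hps; rewrite inE Qps orbT.
rewrite fideal_mulA //.
- by have [] := hps P (mem_head _ _).
- by apply: prime_product_frac => Q Qps; apply: hps; rewrite inE mem_cat Qps orbT.
- by apply: prime_product_frac => Q Qps; apply: hps; rewrite inE mem_cat Qps !orbT.
Qed.

Lemma prime_product_mem P ps : (forall Q, Q \in ps -> prime_ideal Q) -> P \in ps ->
  exists2 ps', (size ps = (size ps').+1) /\ {subset ps' <= ps} &
    prime_product ps = fideal_mul P (prime_product ps').
Proof.
elim: ps => [//|Q ps IH] hps; have hps' R : R \in ps -> prime_ideal R.
  by move=> Rps; apply: hps; rewrite inE Rps orbT.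
rewrite inE => /orP [/eqP ->|Pps].
  by exists ps => //; split=> // R Rps; rewrite inE Rps orbT.
have [ps' [sps' sub] e] := IH hps' Pps; exists (Q :: ps').
  split=> /=; first by rewrite sps'.
  by move=> R; rewrite !inE => /orP [->//|/sub ->]; rewrite orbT.
have [fQ _ _ _ _] := hps Q (mem_head _ _); have [fP _ _ _ _] := hps' P Pps.
have fps' : frac_ideal (prime_product ps').
  by apply: prime_product_frac => R /sub; exact: hps'.
by rewrite /= e !fideal_mulA // [fideal_mul Q P]fideal_mulC.
Qed.


Lemma index_le_proper J J' a N : J `<=` J' -> subgroup J -> subgroup J' ->
  O a -> J' a -> ~ J a -> index_le O J N.+1 -> index_le O J' N.
Proof.
move=> JJ' sJ sJ' Oa J'a nJa [s ss hs].
have [y0 y0s Jy0] := hs 0 (rpred0 _); have [y ys Jy] := hs a Oa.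
have yy0 : y0 != y.
  apply/eqP => e; apply: nJa; rewrite e sub0r in Jy0.
  have -> : a = (a - y) - (- y) by rewrite opprK subrK.
  exact: sJ.2.
exists (rem y s); first by rewrite size_rem // -ltnS; case: s ss ys {hs y0s}.
move=> x /hs [z zs Jz]; have [e|zy] := eqVneq z y; last first.
  exists z; last exact: JJ'.
  by move: zs; rewrite (perm_mem (perm_to_rem ys)) inE (negPf zy).
exists y0; first by move: y0s; rewrite (perm_mem (perm_to_rem ys)) inE (negPf yy0).
have -> : x - y0 = (x - z) - (a - y) + a + (0 - y0).
  by rewrite e; ring.
apply: subgroup_add => //; last exact: JJ'.
apply: subgroup_add => //.
by apply: sJ'.2; exact: JJ'.
Qed.

(** Induction on the index. If [J] is proper and not prime, take [a b] in [J] with neither factor in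
    [J]; then [J + (a)] and [J + (b)] are strictly larger, and their product lies in [J]. *)
Lemma ideal_sub_prime_product N J : frac_ideal J -> J `<=` O ->
  (exists2 a, a != 0 & J a) -> index_le O J N ->
  exists2 ps, forall P, P \in ps -> prime_ideal P & prime_product ps `<=` J.
Proof.
elim: N J => [|N IH] J fJ JO J0.
  case=> s; rewrite leqn0 => /nilP -> hs; have [y] := hs 0 (rpred0 _).
  by rewrite in_nil.
move=> iJ; have [J1|nJ1] := pselect (J 1).
  by exists [::] => // x Ox; rewrite -[x]mulr1; exact: fJ.2.
have [pJ|npJ] := pselect (forall a b, O a -> O b -> J (a * b) -> J a \/ J b).
  exists [:: J]; first by move=> P; rewrite inE => /eqP ->.
  by rewrite /prime_product /= fideal_mulC fideal_mul1.
have [a [b [Oa Ob Jab nJa nJb]]] :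
    exists a b, [/\ O a, O b, J (a * b), ~ J a & ~ J b].
  apply: contra_notP npJ => h a b Oa Ob Jab; have [|nJa] := pselect (J a); first by left.
  by right; apply: contra_notP h => nJb; exists a, b.
pose K c := [set x | exists2 u, J u & exists2 r, O r & x = u + r * c].
have step c : O c -> ~ J c ->
    exists2 ps, forall P, P \in ps -> prime_ideal P & prime_product ps `<=` K c.
  move=> Oc nJc; have fK : frac_ideal (K c) by exact: frac_ideal_span.
  have JK : J `<=` K c.
    by move=> x Jx; exists x => //; exists 0; [exact: rpred0 | rewrite mul0r addr0].
  apply: IH => //.
  - by move=> _ [u Ju [r Or ->]]; apply: rpredD; [exact: JO | exact: ringFM].
  - by have [d d0 Jd] := J0; exists d => //; exact: JK.
  - apply: index_le_proper iJ => //; [exact: fJ.1 | exact: fK.1 | exact: Oc | |exact: nJc].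
    by exists 0; [exact: fJ.1.1 | exists 1; [exact: ringF1 | rewrite mul1r add0r]].
have [ps hps psK] := step a Oa nJa; have [qs hqs qsK] := step b Ob nJb.
have hpq P : P \in ps ++ qs -> prime_ideal P by rewrite mem_cat => /orP [/hps|/hqs].
exists (ps ++ qs) => //; rewrite prime_product_cat //.
apply: fideal_mul_sub fJ.1 _ => x y /psK [u Ju [r Or ->]] /qsK [v Jv [t Ot ->]].
rewrite mulrDl !mulrDr; apply: subgroup_add; first exact: fJ.1.
  apply: subgroup_add; [exact: fJ.1 | | rewrite mulrC].
    by rewrite mulrC; apply: fJ.2 => //; apply: JO.
  by apply: fJ.2 => //; exact: ringFM.
apply: subgroup_add; first exact: fJ.1.
  by apply: fJ.2 => //; exact: ringFM.
by rewrite mulrACA; apply: fJ.2 => //; exact: ringFM.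
Qed.

(** [O/P] is a finite domain, hence a field: two powers of [a] agree modulo [P], and cancelling the
    smaller one exhibits a power of [a] as inverse. If no two agreed, there would be more classes
    than [finO] allows. *)
Lemma prime_unit_mod P a : prime_ideal P -> O a -> ~ P a ->
  exists2 c, O c & P (1 - a * c).
Proof.
move=> [fP PO nP1 pP P0] Oa nPa; have [N iP] := finO fP PO P0.
have [[i [j [ij Pij]]]|h] := pselect (exists i j, (i < j)%N /\ P (a ^+ i - a ^+ j)).
  exists (a ^+ (j - i).-1); first exact: ringFX.
  rewrite -exprS prednK ?subn_gt0 //; set b := 1 - _.
  have Ob : O b by apply: ringFB; [exact: ringF1 | exact: ringFX].
  have {}Pij : P (a ^+ i * b).
    by rewrite mulrBr mulr1 -exprD subnKC // ltnW.
  clearbody b; elim: i Pij {ij} => [|i IH]; first by rewrite expr0 mul1r.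
  rewrite exprS -mulrA => /(pP _ _ Oa) [|//|]; last exact: IH.
  by apply: ringFM => //; exact: ringFX.
have inj i j : P (a ^+ i - a ^+ j) -> i = j.
  move=> Pij; apply: contra_notP h => /eqP; rewrite neq_ltn => /orP [ij|ij].
    by exists i, j.
  by exists j, i; split=> //; rewrite -opprB; apply: subgroup_opp => //; exact: fP.1.
have : index_ge O P N.+1.
  exists [seq a ^+ i | i <- iota 0 N.+1]; split.
  - by rewrite size_map size_iota.
  - rewrite map_inj_uniq ?iota_uniq // => i j e; apply: inj.
    by rewrite e subrr; exact: fP.1.1.
  - by move=> _ /mapP [i _ ->]; exact: ringFX.
  - by move=> _ _ /mapP [i _ ->] /mapP [j _ ->] /inj ->.
by move=> /(index_ge_le fP.1) /(_ iP); rewrite ltnn.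
Qed.

Lemma prime_sub_eq P Q : prime_ideal P -> prime_ideal Q -> Q `<=` P -> Q = P.
Proof.
move=> hP hQ QP; apply/seteqP; split=> // a Pa; apply: contrapT => nQa.
have [fP PO nP1 _ _] := hP.
have [c Oc Qc] := prime_unit_mod hQ (PO _ Pa) nQa; apply: nP1.
rewrite -(subrK (a * c) 1); apply: subgroup_add; [exact: fP.1 | exact: QP |].
by rewrite mulrC; exact: fP.2.
Qed.

Lemma prime_product_sub_prime P ps : prime_ideal P ->
  (forall Q, Q \in ps -> prime_ideal Q) -> prime_product ps `<=` P -> P \in ps.
Proof.
move=> hP; elim: ps => [|Q ps IH] hps psP.
  by have [_ _ nP1 _ _] := hP; case: nP1; apply: psP; exact: ringF1.
have hps' R : R \in ps -> prime_ideal R by move=> Rps; apply: hps; rewrite inE Rps orbT.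
have hQ := hps Q (mem_head _ _).
have [QP|nQP] := pselect (Q `<=` P); first by rewrite (prime_sub_eq hP hQ QP) mem_head.
rewrite inE IH ?orbT // => y psy.
have [q [Qq nPq]] : exists q, Q q /\ ~ P q.
  by apply: contra_notP nQP => h q Qq; apply: contrapT => nPq; apply: h; exists q.
have [_ _ _ pP _] := hP; have [_ QO _ _ _] := hQ.
have Pqy : P (q * y) by apply: psP; exact: fideal_mul_mem.
by have [] := pP q y (QO _ Qq) (prime_product_sub hps' psy) Pqy.
Qed.

(** Take a shortest product of primes inside a principal ideal [(a)] contained in [P]. It has [P] as
    a factor, and the remaining product contains some [b] outside [(a)]; then [b / a] works. *)
Lemma prime_inv_nontrivial P : prime_ideal P -> exists2 x, fideal_inv P x & ~ O x.
Proof.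
move=> hP; have [fP PO nP1 _ [a a0 Pa]] := hP.
pose A := [set x | exists2 r, O r & x = r * a].
have fA : frac_ideal A.
  split; first split.
  - by exists 0; [exact: rpred0 | rewrite mul0r].
  - move=> _ _ [r Or ->] [t Ot ->]; exists (r - t); first exact: ringFB.
    by rewrite mulrBl.
  - by move=> c _ Oc [r Or ->]; exists (c * r); [exact: ringFM | rewrite mulrA].
have AO : A `<=` O by move=> _ [r Or ->]; apply: ringFM => //; exact: PO.
have AP : A `<=` P by move=> _ [r Or ->]; exact: fP.2.
have Aa : A a by exists 1; [exact: ringF1 | rewrite mul1r].
have A0 : exists2 c, c != 0 & A c by exists a.
have [N iA] := finO fA AO A0.
have [ps hps psA] := ideal_sub_prime_product fA AO A0 iA.
(* Descent on the length: if the product stays inside [A] after [P] is removed, start again with the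
   shorter list. *)
have [m] := ubnP (size ps); elim: m ps hps psA => [//|m IH] ps hps psA.
rewrite ltnS => sz.
have Pps : P \in ps by apply: prime_product_sub_prime hP hps _ => x /psA /AP.
have [ps' [sps' sub] e] := prime_product_mem hps Pps.
have hps' Q : Q \in ps' -> prime_ideal Q by move=> /sub; exact: hps.
have [ps'A|nps'A] := pselect (prime_product ps' `<=` A).
  by apply: (IH ps') => //; rewrite sps' in sz.
have [b [psb nAb]] : exists b, prime_product ps' b /\ ~ A b.
  by apply: contra_notP nps'A => h b psb; apply: contrapT => nAb; apply: h; exists b.
exists (b / a).
  move=> y Py; have [r Or] : A (y * b) by apply: psA; rewrite e; exact: fideal_mul_mem.
  by move=> yb; rewrite mulrAC [b * y]mulrC yb mulfK.
by move=> Oba; apply: nAb; exists (b / a) => //; rewrite divfK.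
Qed.

(** [E = P P^-1] lies between [P] and [O]. If [E] were contained in [P], every element of [P^-1]
    would stabilize [P] and so be integral, contrary to [prime_inv_nontrivial]. Otherwise [E]
    contains a unit modulo [P], and with [P] it contains [1]. *)
Lemma prime_invertible P : prime_ideal P -> fideal_mul P (fideal_inv P) = O.
Proof.
move=> hP; have [fP PO nP1 _ P0] := hP.
set E := fideal_mul _ _.
have fE : frac_ideal E by exact: frac_ideal_mul.
have EO : E `<=` O.
  apply: fideal_mul_sub frac_ideal_ringF.1 _ => x y Px hy.
  by rewrite mulrC; exact: hy.
suff E1 : E 1.
  by apply/seteqP; split=> // x Ox; rewrite -[x]mulr1; exact: fE.2.
have PE : P `<=` E.
  move=> x Px; rewrite -[x]mulr1; apply: fideal_mul_mem => // y Py.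
  by rewrite mul1r; exact: PO.
have [EP|nEP] := pselect (E `<=` P).
  have [x hx nOx] := prime_inv_nontrivial hP; case: nOx.
  apply: closedO fP PO P0 _ => y Py; rewrite mulrC.
  by apply: EP; exact: fideal_mul_mem.
have [b [Eb nPb]] : exists b, E b /\ ~ P b.
  by apply: contra_notP nEP => h b Eb; apply: contrapT => nPb; apply: h; exists b.
have [c Oc Pbc] := prime_unit_mod hP (EO _ Eb) nPb.
rewrite -(subrK (b * c) 1); apply: subgroup_add; [exact: fE.1 | exact: PE |].
by rewrite mulrC; exact: fE.2.
Qed.

Definition invertible J :=
  frac_ideal J /\ exists2 K, frac_ideal K & fideal_mul J K = O.

Lemma invertible_ringF : invertible O.
Proof.
have fO := frac_ideal_ringF.
by split=> //; exists O => //; exact: fideal_mul1.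
Qed.

Lemma invertible_mul I J : invertible I -> invertible J -> invertible (fideal_mul I J).
Proof.
move=> [fI [I' fI' eI]] [fJ [J' fJ' eJ]]; split; first exact: frac_ideal_mul.
exists (fideal_mul J' I'); first exact: frac_ideal_mul.
rewrite fideal_mulA //; last exact: frac_ideal_mul.
by rewrite -(fideal_mulA fI) // eJ [fideal_mul I O]fideal_mulC fideal_mul1.
Qed.

Lemma invertible_prime P : prime_ideal P -> invertible P.
Proof.
move=> hP; have [fP _ _ _ _] := hP; split=> //.
by exists (fideal_inv P); [exact: frac_ideal_inv | exact: prime_invertible].
Qed.

Lemma invertible_prime_inv P : prime_ideal P -> invertible (fideal_inv P).
Proof.
move=> hP; have [fP _ _ _ _] := hP; split; first exact: frac_ideal_inv.
by exists P => //; rewrite fideal_mulC prime_invertible.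
Qed.

(** Multiplying [J = P J] by an inverse of [J] would put [1] in [P]. *)
Lemma fideal_mul_prime_proper P J : prime_ideal P -> invertible J ->
  exists2 a, J a & ~ fideal_mul P J a.
Proof.
move=> hP [fJ [K fK JK]]; have [fP _ nP1 _ _] := hP.
apply: contrapT => h; apply: nP1.
have JPJ : J `<=` fideal_mul P J.
  by move=> a Ja; apply: contrapT => nPJ; apply: h; exists a.
have : fideal_mul J K 1 by rewrite JK; exact: ringF1.
move=> /(fideal_mulS JPJ (@subset_refl _ K)).
by rewrite -fideal_mulA // JK fideal_mulC fideal_mul1.
Qed.

(* Multiplication by an element of [J] outside [P J] identifies [O / P] with
   [J / P J]. *)
Lemma index_ge_prime_mul P J N : prime_ideal P -> invertible J ->
  index_ge O P N -> index_ge J (fideal_mul P J) N.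
Proof.
move=> hP iJ [s [ss us sO hs]]; have [a Ja nPJa] := fideal_mul_prime_proper hP iJ.
have [fP PO _ _ _] := hP; have fJ := iJ.1; have fPJ := frac_ideal_mul J fP.
have inj : {in s &, forall x y, fideal_mul P J (a * x - a * y) -> x = y}.
  move=> x y xs ys; rewrite -mulrBr => h; apply: hs => //.
  apply: contrapT => nPxy.
  have [c Oc Pc] := prime_unit_mod hP (ringFB (sO _ xs) (sO _ ys)) nPxy.
  apply: nPJa; have -> : a = c * (a * (x - y)) + (1 - (x - y) * c) * a by ring.
  apply: subgroup_add; [exact: fPJ.1 | exact: fPJ.2 |].
  exact: fideal_mul_mem.
exists [seq a * x | x <- s]; split.
- by rewrite size_map.
- rewrite map_inj_in_uniq // => x y xs ys e; apply: inj => //.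
  by rewrite e subrr; exact: fPJ.1.1.
- by move=> _ /mapP [x xs ->]; rewrite mulrC; apply: fJ.2 => //; exact: sO.
- by move=> _ _ /mapP [x xs ->] /mapP [y ys ->] /inj ->.
Qed.

(** Surjectivity of multiplication by [a] from [O / P] to [J / P J]. With [z] in the inverse of [J]
    such that [a z] is outside [P], and [c] inverse to [a z] modulo [P], each [x] in [J] is
    congruent to [a (c x z)], where [c x z] lies in [O]. *)
Lemma index_le_prime_mul P J N : prime_ideal P -> invertible J ->
  index_le O P N -> index_le J (fideal_mul P J) N.
Proof.
move=> hP iJ [s ss hs]; have [a Ja nPJa] := fideal_mul_prime_proper hP iJ.
have [fP PO _ _ _] := hP; have [fJ [K fK JK]] := iJ; have fPJ := frac_ideal_mul J fP.
have KO x z : J x -> K z -> O (x * z) by move=> Jx Kz; rewrite -JK; exact: fideal_mul_mem.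
(* Otherwise, writing [1] as a sum of products from [J] and [K] would put [a] in [P J]. *)
have [z Kz nPz] : exists2 z, K z & ~ P (a * z).
  apply: contrapT => h; apply: nPJa.
  have [t [ht e]] : fideal_mul J K 1 by rewrite JK; exact: ringF1.
  rewrite -[a]mulr1 e mulr_sumr big_seq.
  apply: (big_ind (fideal_mul P J)); first exact: fPJ.1.1.
    by move=> *; apply: subgroup_add => //; exact: fPJ.1.
  move=> u /ht [Ju Ku]; rewrite [u.1 * _]mulrC mulrA; apply: fideal_mul_mem => //.
  by apply: contrapT => nP; apply: h; exists u.2.
have [c Oc Pc] := prime_unit_mod hP (KO _ _ Ja Kz) nPz.
exists [seq a * y | y <- s]; first by rewrite size_map.
move=> x Jx; have [y ys Py] := hs (c * (x * z)) (ringFM Oc (KO _ _ Jx Kz)).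
exists (a * y); first exact: map_f.
have -> : x - a * y = (1 - a * z * c) * x + (c * (x * z) - y) * a by ring.
by apply: subgroup_add; [exact: fPJ.1 | |]; exact: fideal_mul_mem.
Qed.


Lemma invertible_prime_product ps : (forall P, P \in ps -> prime_ideal P) ->
  invertible (prime_product ps).
Proof.
elim: ps => [|P ps IH] hps; first exact: invertible_ringF.
apply: invertible_mul; first exact/invertible_prime/hps/mem_head.
by apply: IH => Q Qps; apply: hps; rewrite inE Qps orbT.
Qed.

Section IndexPrimeProduct.
Variables (N : set F -> nat) (ps : seq (set F)) (J : set F).
Hypothesis prime_ps : forall P, P \in ps -> prime_ideal P.
Hypothesis invJ : invertible J.

Lemma index_le_prime_product : (forall P, P \in ps -> index_le O P (N P)) ->
  index_le J (fideal_mul (prime_product ps) J) (\prod_(P <- ps) N P).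
Proof.
elim: ps prime_ps => [|P qs IH] hps hN.
  rewrite /= fideal_mul1 ?big_nil; last exact: invJ.1.
  by exists [:: 0] => // x Jx; exists 0; rewrite ?mem_head ?subr0.
have hqs Q : Q \in qs -> prime_ideal Q by move=> Qps; apply: hps; rewrite inE Qps orbT.
have hP := hps P (mem_head _ _); have [fP _ _ _ _] := hP.
have iqs := invertible_prime_product hqs.
rewrite big_cons mulnC /= -fideal_mulA //; [|exact: iqs.1|exact: invJ.1].
apply: index_le_trans (IH hqs _) _ => [Q Qqs|].
  by apply: hN; rewrite inE Qqs orbT.
by apply: index_le_prime_mul => //; [exact: invertible_mul | exact/hN/mem_head].
Qed.

Lemma index_ge_prime_product : (forall P, P \in ps -> index_ge O P (N P)) ->
  index_ge J (fideal_mul (prime_product ps) J) (\prod_(P <- ps) N P).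
Proof.
elim: ps prime_ps => [|P qs IH] hps hN.
  rewrite /= fideal_mul1 ?big_nil; last exact: invJ.1.
  exists [:: 0]; split=> // [x|x y]; first by rewrite inE => /eqP ->; exact: invJ.1.1.1.
  by rewrite !inE => /eqP -> /eqP ->.
have hqs Q : Q \in qs -> prime_ideal Q by move=> Qps; apply: hps; rewrite inE Qps orbT.
have hP := hps P (mem_head _ _); have [fP PO _ _ _] := hP.
have iqs := invertible_prime_product hqs; have iqJ := invertible_mul iqs invJ.
rewrite big_cons mulnC /= -fideal_mulA //; [|exact: iqs.1|exact: invJ.1].
apply: index_ge_trans (IH hqs _) _ => [|||||Q Qqs|].
- exact: invJ.1.1.
- apply: (fideal_mul_sub invJ.1.1) => x y /(prime_product_sub hqs) Ox Jy.
  by apply: invJ.1.2.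
- exact: iqJ.1.1.
- exact: (frac_ideal_mul _ fP).1.1.
- apply: (fideal_mul_sub iqJ.1.1) => x y /PO Ox Jy; exact: iqJ.1.2.
- by apply: hN; rewrite inE Qqs orbT.
- by apply: index_ge_prime_mul => //; exact/hN/mem_head.
Qed.
End IndexPrimeProduct.
End FractionalIdeals.

(** * Lattices and determinants *)

Lemma subgroup_mulz (V : zmodType) (J : set V) x (a : int) :
  subgroup J -> J x -> J (x *~ a).
Proof.
move=> sJ Jx; have Jn k : J (x *+ k).
  elim: k => [|k IH]; first by rewrite mulr0n; exact: sJ.1.
  by rewrite mulrS; exact: subgroup_add.
case: a => k; first exact: Jn.
by rewrite NegzE mulrNz; apply: subgroup_opp => //; exact: Jn.
Qed.

Lemma subgroup_sum (V : zmodType) (J : set V) (I : Type) (r : seq I) (f : I -> V) :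
  subgroup J -> (forall i, J (f i)) -> J (\sum_(i <- r) f i).
Proof.
move=> sJ Jf; apply: big_ind => // [|x y Jx Jy]; first exact: sJ.1.
exact: subgroup_add.
Qed.

(** By the Smith normal form [M = L D U] with [L], [U] unimodular, it is enough to divide with
    remainder by the diagonal entries of [D]. *)
Lemma index_le_det k (M : 'M[int]_k) : \det M != 0 ->
  index_le [set: 'rV[int]_k] [set z *m M | z in [set: 'rV[int]_k]] `|\det M|.
Proof.
have [L Lu [U Uu [d _ ->]]] := int_Smith_normal_form M.
set D := \matrix_(_, _) _.
have -> : `|\det (L *m D *m U)|%N = `|\det D|%N.
  have unit1 (a : int) : a \is a GRing.unit -> `|a|%N = 1%N.
    by rewrite qualifE /= => /orP [] /eqP ->.
  by rewrite !det_mulmx !abszM (unit1 (\det L)) // (unit1 (\det U)) // mul1n muln1.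
rewrite !det_mulmx !mulf_eq0 !negb_or => /andP [/andP [_ D0] _].
have Dd : D = diag_mx (\row_i d`_i).
  by apply/matrixP => i j; rewrite !mxE.
have detD : \det D = \prod_(i < k) d`_i.
  by rewrite Dd det_diag; apply: eq_bigr => i _; rewrite mxE.
have d0 (i : 'I_k) : d`_i != 0 by move: D0; rewrite detD => /prodf_neq0 ->.
(* One representative for each vector of remainders, so their number is the product of the
   [|d_i|]. *)
pose T := {dffun forall i : 'I_k, 'I_(`|d`_i|)}.
exists [seq (\row_i (Posz (f i))) *m U | f : T].
  rewrite size_map -cardT card_dep_ffun detD.
  rewrite (big_morph _ abszM absz1) foldrE big_map big_enum /=.
  by under eq_bigr do rewrite card_ord.
move=> x _; have [w ->] : exists w : 'rV[int]_k, x = w *m U.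
  by exists (x *m invmx U); rewrite mulmxKV.
pose r (i : 'I_k) := modz (w 0 i) d`_i.
have r_lt i : (`|r i| < `|(d`_i)%R|)%N.
  by rewrite -ltz_nat !abszE ger0_norm ?modz_ge0 ?ltz_mod.
pose f : T := [ffun i => Ordinal (r_lt i)].
exists ((\row_i Posz (f i)) *m U).
  by apply/mapP; exists f => //; rewrite mem_enum.
exists ((\row_i divz (w 0 i) d`_i) *m invmx L) => //.
rewrite mulmxA -mulmxBl; congr (_ *m _).
rewrite !mulmxA mulmxKV // Dd; apply/rowP => i; rewrite mul_mx_diag !mxE ffunE /=.
rewrite abszE ger0_norm ?modz_ge0 //.
by rewrite {2}(divz_eq (w 0 i) d`_i) addrK.
Qed.

(** * Ideals compared with the lattice spanned by an integral basis *)

Section Lattices.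
Variables (F : fieldExtType rat) (n : nat) (b : n.+1.-tuple F).
Hypothesis basis_b : basis_of fullv b.
Hypothesis integral_b : forall i : 'I_n.+1, b`_i \in @ring_int F.
Local Notation O := (@ringF F).

(** The rows of [A] are the [b]-coordinates of generators: [A = 1] gives [Zb], and [A = mul_mx b f]
    gives [f Zb]. *)
Definition int_comb (A : 'M[rat]_n.+1) (k : 'rV[int]_n.+1) : F :=
  vec_of b (map_mx intr k *m A).

Lemma int_comb_is_zmod_morphism A : zmod_morphism (int_comb A).
Proof.
move=> x y; rewrite /int_comb -linearB -mulmxBl; congr (vec_of _ (_ *m _)).
by apply/rowP => i; rewrite !mxE rmorphB.
Qed.
HB.instance Definition _ A := GRing.isZmodMorphism.Build _ _ _ (int_comb_is_zmod_morphism A).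

Definition lattice A : set F := range (int_comb A).

Definition scale (m : F) (J : set F) : set F := ( *%R m) @` J.

Lemma subgroup_scale m (J : set F) : subgroup J -> subgroup (scale m J).
Proof.
move=> sJ; split; first by exists 0; [exact: sJ.1 | rewrite mulr0].
by move=> _ _ [x Jx <-] [y Jy <-]; exists (x - y); [exact: sJ.2 | rewrite mulrBr].
Qed.

Lemma scaleS m (J K : set F) : J `<=` K -> scale m J `<=` scale m K.
Proof. by move=> JK _ [x /JK Kx <-]; exists x. Qed.

Lemma scale_scale m m' (J : set F) : scale m (scale m' J) = scale (m * m') J.
Proof.
apply/seteqP; split=> [_ [_ [x Jx <-] <-]|_ [x Jx <-]].
  by exists x; rewrite ?mulrA.
by exists (m' * x); rewrite ?mulrA //; exists x.
Qed.

Lemma scale1 (J : set F) : scale 1 J = J.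
Proof.
apply/seteqP; split=> [_ [x Jx <-]|x Jx]; first by rewrite mul1r.
by exists x; rewrite ?mul1r.
Qed.

Lemma scale_lattice (m : rat) A : scale (in_alg F m) (lattice A) = lattice (m *: A).
Proof.
have e k : in_alg F m * int_comb A k = int_comb (m *: A) k.
  by rewrite /int_comb -scalemxAr linearZ /= -scalerAl mul1r.
apply/seteqP; split=> [_ [_ [k _ <-] <-]|_ [k _ <-]].
  by exists k => //; rewrite -e.
by exists (int_comb A k); [exists k | exact: e].
Qed.

Lemma scale_frac_sub (J : set F) (m : nat) : frac_ideal J -> scale m%:R J `<=` J.
Proof. by move=> fJ _ [x Jx <-]; apply: fJ.2 => //; exact: rpred_nat. Qed.

Lemma lattice1_ringF : lattice 1%:M `<=` O.
Proof. by move=> _ [k _ <-]; rewrite /int_comb mulmx1; exact: int_vec_ring_int. Qed.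

Lemma index_le_lattice (M : 'M[int]_n.+1) : \det M != 0 ->
  index_le (lattice 1%:M) (lattice (map_mx intr M)) `|\det M|.
Proof.
move=> /index_le_det /(@index_le_image _ _ (int_comb 1%:M)).
apply: index_leS => // _ [_ [z _ <-] <-]; exists z => //.
by rewrite /= /int_comb mulmx1 map_mxM.
Qed.

(** The representatives are the vectors with coordinates in [[0, m)]. *)
Lemma index_ge_lattice (m : nat) :
  index_ge (lattice 1%:M) (lattice (m%:R *: 1%:M)) (m ^ n.+1).
Proof.
pose f (k : 'rV['I_m]_n.+1) := int_comb 1%:M (map_mx (fun i : 'I_m => Posz i) k).
have inj : forall k k', lattice (m%:R *: 1%:M) (f k - f k') -> k = k'.
  move=> k k' [z _]; rewrite -raddfB /= /int_comb mulmx1 -scalemxAr mulmx1.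
  move=> /(congr1 (coords b)); rewrite !vec_ofK // => /rowP h; apply/rowP => i.
  apply: val_inj; have := h i; rewrite !mxE -[m%:R]/((Posz m)%:~R) -intrM => /intr_inj.
  have := ltn_ord (k 0 i); have := ltn_ord (k' 0 i) => /=.
  move: (z 0 i) (nat_of_ord _) (nat_of_ord _) => a u v um vm.
  by have [a0|a0|->] := ltgtP a 0; nia.
exists [seq f k | k : 'rV['I_m]_n.+1]; split.
- by rewrite size_map -cardT card_mx card_ord mul1n.
- rewrite map_inj_uniq ?enum_uniq // => k k' e; apply: inj.
  by rewrite e subrr; exists 0 => //; rewrite raddf0.
- by move=> _ /mapP [k _ ->]; exists (map_mx (fun i : 'I_m => Posz i) k).
- by move=> _ _ /mapP [k _ ->] /mapP [k' _ ->] /inj ->.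
Qed.

Lemma natr_in_alg (m : nat) : in_alg F m%:R = m%:R.
Proof. by rewrite rmorph_nat. Qed.

Lemma lattice_nat (m : nat) : lattice (m%:R *: 1%:M) = scale m%:R (lattice 1%:M).
Proof. by rewrite -scale_lattice natr_in_alg. Qed.

Definition lmul (m x : F) : F := m * x.
Lemma lmul_is_zmod_morphism m : zmod_morphism (lmul m).
Proof. by move=> x y; exact: mulrBr. Qed.
HB.instance Definition _ m := GRing.isZmodMorphism.Build _ _ _ (lmul_is_zmod_morphism m).

Lemma index_le_scale m (K J : set F) N : index_le K J N -> index_le (scale m K) (scale m J) N.
Proof. by move=> h; have := index_le_image (lmul m) h. Qed.

Lemma index_ge_scale m (K J : set F) N : m != 0 ->
  index_ge K J N -> index_ge (scale m K) (scale m J) N.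
Proof. by move=> /mulfI mI h; have := index_ge_image (h := lmul m) mI h. Qed.

Lemma natr_neq0 (m : nat) : (0 < m)%N -> (m%:R : F) != 0.
Proof.
by move=> m0; rewrite -natr_in_alg fmorph_eq0 pnatr_eq0 -lt0n.
Qed.

Section Denominator.
Variable d : nat.
Hypothesis d_gt0 : (0 < d)%N.
Hypothesis sub_d : scale d%:R O `<=` lattice 1%:M.

(** [O] is contained in [d^-1 Zb], in which [m Zb] has index at most [(d m)^n], with [n] the
    degree. *)
Lemma index_le_ringF (m : nat) : (0 < m)%N ->
  index_le O (lattice (m%:R *: 1%:M)) ((d * m) ^ n.+1).
Proof.
move=> m0; pose M : 'M[int]_n.+1 := (Posz (d * m))%:M.
have detM : \det M = Posz ((d * m) ^ n.+1).
  by rewrite det_scalar -rmorphXn.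
have dm0 : (0 < (d * m) ^ n.+1)%N by rewrite expn_gt0 muln_gt0 d_gt0 m0.
have M0 : \det M != 0 by rewrite detM -lt0n.
have := index_le_lattice M0; rewrite detM absz_nat => h.
have := index_le_scale d%:R^-1 (index_leS sub_d (@subset_refl _ _) (leqnn _) h).
rewrite scale_scale mulVf ?natr_neq0 // scale1 => {}h.
apply: index_leS h => //.
have -> : map_mx intr M = (d * m)%:R *: 1%:M :> 'M[rat]_n.+1.
  by rewrite map_scalar_mx scalemx1.
rewrite !lattice_nat natrM scale_scale mulrA mulVf ?natr_neq0 // mul1r.
exact: subset_refl.
Qed.
End Denominator.

Lemma ringF_denominator : exists2 d : nat, (0 < d)%N & scale d%:R O `<=` lattice 1%:M.
Proof.
have [d d0 hd] := ring_int_sub_lattice basis_b integral_b.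
exists d => // _ [x /hd [k e] <-]; exists k => //.
by rewrite e /int_comb mulmx1.
Qed.

(** If [m / a] is integral with [a] in [J], then [m = (m / a) a] lies in [J]. *)
Lemma ideal_contains_lattice (J : set F) : frac_ideal J -> (exists2 a, a != 0 & J a) ->
  exists2 m : nat, (0 < m)%N & lattice (m%:R *: 1%:M) `<=` J.
Proof.
move=> fJ [a a0 Ja]; have [m m0 Om] := ring_int_scale basis_b a^-1.
exists m => //; rewrite lattice_nat => _ [x /lattice1_ringF Ox <-].
rewrite mulrC; apply: fJ.2 => //.
have -> : m%:R = m%:R * a^-1 * a by rewrite divfK.
exact: fJ.2.
Qed.

Lemma ringF_residually_finite : residually_finite F.
Proof.
move=> J fJ JO J0; have [d d0 hd] := ringF_denominator.
have [m m0 mJ] := ideal_contains_lattice fJ J0.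
exists ((d * m) ^ n.+1)%N.
by apply: index_leS (index_le_ringF d0 hd m0).
Qed.

Lemma index_le_mem (V : zmodType) (K J : set V) N : subgroup J -> index_le K J N ->
  exists2 s : seq V, {in s, forall x, K x} & forall x, K x -> exists2 y, y \in s & J (x - y).
Proof.
move=> sJ [s _ hs].
have /choice [g hg] : forall y, exists z, (exists x, K x /\ J (x - y)) -> K z /\ J (z - y).
  move=> y; have [[x hx]|h] := pselect (exists x, K x /\ J (x - y)); first by exists x.
  by exists 0.
exists [seq g y | y <- s & `[< exists x, K x /\ J (x - y) >]].
  move=> _ /mapP [y + ->]; rewrite mem_filter => /andP [/asboolP h _].
  by case: (hg y h).
move=> x Kx; have [y ys Jxy] := hs x Kx.
have h : exists x, K x /\ J (x - y) by exists x.
exists (g y).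
  by apply/mapP; exists y => //; rewrite mem_filter ys andbT; apply/asboolP.
have [_ Jg] := hg y h.
have -> : x - g y = (x - y) - (g y - y) by rewrite opprB addrA subrK.
exact: sJ.2.
Qed.

(** [J] contains some [m Zb] with finite index; the [m b_i], together with coset representatives
    chosen inside [J], generate it over the integers. *)
Lemma ideal_finitely_generated (J : set F) : frac_ideal J -> J `<=` O ->
  (exists2 a, a != 0 & J a) -> exists g : seq F,
  [/\ uniq g, {in g, forall x, J x} & forall x, J x -> exists c : F -> int,
      x = \sum_(u <- g) u *~ c u].
Proof.
move=> fJ JO J0; have [d d0 hd] := ringF_denominator.
have [m m0 mJ] := ideal_contains_lattice fJ J0.
set L := lattice _ in mJ.
have sL : subgroup L.
  split; first by exists 0 => //; rewrite raddf0.
  by move=> _ _ [k _ <-] [k' _ <-]; exists (k - k') => //; rewrite raddfB.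
have [s sJ hs] := index_le_mem sL (index_leS JO (@subset_refl _ _) (leqnn _)
  (index_le_ringF d0 hd m0)).
pose g := undup (s ++ [seq int_comb (m%:R *: 1%:M) (delta_mx 0 i) | i : 'I_n.+1]).
pose G : set F := [set x | exists c : F -> int, x = \sum_(u <- g) u *~ c u].
have sG : subgroup G.
  split; first by exists (fun=> 0); rewrite big1.
  move=> _ _ [c ->] [c' ->]; exists (fun u => c u - c' u).
  by rewrite -sumrB; apply: eq_bigr => u _; rewrite mulrzBr.
have gG u : u \in g -> G u.
  move=> ug; exists (fun v => Posz (v == u)).
  rewrite (bigD1_seq u) ?undup_uniq //= eqxx big1 ?addr0 // => v /negPf ->.
  by rewrite mulr0z.
exists g; split; first exact: undup_uniq.
  move=> x; rewrite mem_undup mem_cat => /orP [/sJ//|/mapP [i _ ->]].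
  by apply: mJ; exists (delta_mx 0 i).
move=> x /hs [y ys [k _ exy]]; apply: (_ : G x).
rewrite -(subrK y x); apply: subgroup_add => //; last first.
  by apply: gG; rewrite mem_undup mem_cat ys.
rewrite -exy (matrix_sum_delta k) big_ord1 raddf_sum /=.
apply: subgroup_sum => // i.
have -> : k 0 i *: delta_mx 0 i = delta_mx 0 i *~ k 0 i :> 'rV[int]_n.+1.
  by rewrite -scaler_int intz.
rewrite raddfMz; apply: subgroup_mulz => //; apply: gG.
rewrite mem_undup mem_cat; apply/orP; right.
by apply/mapP; exists i => //; rewrite mem_enum.
Qed.

(** Multiplication by [x] acts on finitely many generators of [J] through an integer matrix, with
    the nonzero row of generators as eigenvector. *)
Lemma ringF_stabilizer_integral : stabilizer_integral F.
Proof.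
move=> J x fJ JO J0 xJ.
have [g [ug gJ hg]] := ideal_finitely_generated fJ JO J0.
have /choice [A hA] : forall j : 'I_(size g), exists c : F -> int,
    x * g`_j = \sum_(u <- g) u *~ c u.
  by move=> j; apply/hg/xJ/gJ/mem_nth.
apply: (@ring_int_eigen _ _ (\matrix_(i, j) A j g`_i) (\row_i g`_i)).
  have [a a0 Ja] := J0; apply: contra_neq a0 => /rowP g0.
  have [c ->] := hg a Ja; rewrite big_seq big1 // => u ugg.
  have := g0 (Ordinal (etrans (index_mem u g) ugg)).
  by rewrite !mxE /= nth_index // => ->; rewrite mul0rz.
apply/rowP => j; rewrite !mxE hA (big_nth 0) big_mkord; apply: eq_bigr => i _.
by rewrite !mxE mulrzr.
Qed.

Section DeterminantBound.
Variable d : nat.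
Hypothesis d_gt0 : (0 < d)%N.
Hypothesis sub_d : scale d%:R O `<=` lattice 1%:M.

(* After scaling by [m = d * m1] so that [m C] is integral, compare two estimates
   of the index of [m A] in [O], through [m L(C)] and through [m O]. *)
Lemma lattice_det_lower (C : 'M[rat]_n.+1) (A : set F) NA NB : \det C != 0 ->
  frac_ideal A -> A `<=` O -> index_le (lattice C) A NB -> index_ge O A NA ->
  (NA%:R : rat) <= (d ^ (n.+1 + n.+1))%:R * `|\det C| * NB%:R.
Proof.
move=> C0 fA AO iCA iOA.
have [m1 m10 [g hg]] := common_denominator (fun t : 'I_n.+1 * 'I_n.+1 => C t.1 t.2).
pose m := (d * m1)%N; have m0 : (0 < m)%N by rewrite muln_gt0 d_gt0.
pose M : 'M[int]_n.+1 := Posz d *: \matrix_(i, j) g (i, j).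
have MC : map_mx intr M = m%:R *: C.
  by apply/matrixP => i j; rewrite !mxE natrM -mulrA (hg (i, j)) rmorphM.
have detM : (\det M)%:~R = (m ^ n.+1)%:R * \det C :> rat.
  by rewrite -det_map_mx MC detZ natrX.
have M0 : \det M != 0.
  by rewrite -(intr_eq0 rat) detM mulf_neq0 // pnatr_eq0 -lt0n expn_gt0 m0.
have mF : (m%:R : F) != 0 by exact: natr_neq0.
(* Chain [O], [Zb], [m L(C)], [m A]: the first link costs the factor [d^n]. *)
have up : index_le O (scale m%:R A) ((d * 1) ^ n.+1 * (`|\det M| * NB)).
  apply: index_le_trans (index_le_ringF d_gt0 sub_d (ltn0Sn 0)) _.
  rewrite scale1r; apply: index_le_trans (index_le_lattice M0) _.
  by rewrite MC -scale_lattice natr_in_alg; exact: index_le_scale.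
have fO : frac_ideal O by exact: frac_ideal_ringF.
have mOL : scale m%:R O `<=` scale m1%:R (lattice 1%:M).
  by rewrite /m mulnC natrM -scale_scale; apply: scaleS.
(* Since [m O] is contained in [m1 Zb], its index is bounded below by [m1^n] instead of [m^n]. This
   loses a second [d^n], whence the exponent [n.+1 + n.+1]. *)
have down : index_ge O (scale m%:R A) (m1 ^ n.+1 * NA).
  apply: (@index_ge_trans _ O (scale m%:R O)).
  - exact: fO.1.
  - exact: scale_frac_sub.
  - exact/subgroup_scale/fO.1.
  - exact: (subgroup_scale _ fA.1).1.
  - exact: scaleS.
  - apply: index_geS (index_ge_lattice m1); first exact: lattice1_ringF.
    by rewrite lattice_nat.
  - exact: index_ge_scale.
have := index_ge_le (subgroup_scale m%:R fA.1) down up.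
rewrite muln1 -(ler_nat rat) !natrM natr_absz intr_norm detM normrM ger0_norm //.
have X0 : (0 : rat) < (m1 ^ n.+1)%:R by rewrite ltr0n expn_gt0 m10.
rewrite /m expnMn natrM.
have -> (x y w v : rat) : x * (x * y * w * v) = y * (x * x * w * v) by ring.
by rewrite ler_pM2l // expnD natrM.
Qed.

Variables (N : set F -> nat) (ps qs : seq (set F)).
Hypothesis prime_ps : forall P, P \in ps -> prime_ideal P.
Hypothesis prime_qs : forall P, P \in qs -> prime_ideal P.
Hypothesis N_ps : forall P, P \in ps -> index_ge O P (N P).
Hypothesis N_qs : forall P, P \in qs -> index_le O P (N P).

Let finO := ringF_residually_finite.
Let closedO := ringF_stabilizer_integral.

Lemma index_ge_prime_product_ringF :
  index_ge O (prime_product ps) (\prod_(P <- ps) N P).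
Proof.
have := index_ge_prime_product finO closedO prime_ps (invertible_ringF F) N_ps.
by rewrite fideal_mulC fideal_mul1 //; exact: prime_product_frac.
Qed.

(** Apply the determinant bound to [f Zb], which is contained in [f O]: [f B] has index at most
    [N(B)] in [f O] and is contained in [A]. *)
Lemma norm_lower f : f != 0 ->
  (forall x, prime_product qs x -> prime_product ps (f * x)) ->
  ((\prod_(P <- ps) N P)%:R : rat) <=
    (d ^ (n.+1 + n.+1))%:R * `|\det (mul_mx b f)| * (\prod_(P <- qs) N P)%:R.
Proof.
move=> f0 hf; apply: (@lattice_det_lower _ (prime_product ps)).
- by have := mul_mx_unit basis_b f0; rewrite unitmxE unitfE.
- exact: prime_product_frac.
- exact: prime_product_sub.
- have := index_le_prime_product finO closedO prime_qs (invertible_ringF F) N_qs.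
  rewrite fideal_mulC fideal_mul1; last exact: prime_product_frac.
  move=> /(index_le_scale f); apply: index_leS => //; last by move=> _ [x /hf ? <-].
  move=> _ [k _ <-]; exists (int_comb 1%:M k).
    by apply: lattice1_ringF; exists k.
  by rewrite /int_comb vec_of_mul // mulmx1 mulrC.
- exact: index_ge_prime_product_ringF.
Qed.

(** Here [I] itself is the lattice: [B I] has index at most [N(B)] in [I] and is contained in
    [A]. *)
Lemma lattice_lower (I : set F) C : \det C != 0 -> invertible I -> I = lattice C ->
  (forall f x, I f -> prime_product qs x -> prime_product ps (f * x)) ->
  ((\prod_(P <- ps) N P)%:R : rat) <=
    (d ^ (n.+1 + n.+1))%:R * `|\det C| * (\prod_(P <- qs) N P)%:R.
Proof.
move=> C0 iI IC hI; have fps := prime_product_frac prime_ps.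
apply: (@lattice_det_lower _ (prime_product ps)) => //.
- exact: prime_product_sub.
- have := index_le_prime_product finO closedO prime_qs iI N_qs.
  rewrite IC; apply: index_leS => //; rewrite -IC; apply: fideal_mul_sub fps.1 _.
  by move=> x y Bx Iy; rewrite mulrC; exact: hI.
- exact: index_ge_prime_product_ringF.
Qed.
End DeterminantBound.
End Lattices.

(** * The ideal of a divisor *)

Section FinitePrimes.
Local Open Scope quotient_scope.
Variable F : fieldExtType rat.
Local Notation O := (@ringF F).

Lemma intvalD (x y : OF F) : intval (x + y) = intval x + intval y.
Proof. exact: (rmorphD (\val : OF F -> F)). Qed.
Lemma intvalM (x y : OF F) : intval (x * y) = intval x * intval y.
Proof. exact: (rmorphM (\val : OF F -> F)). Qed.
Lemma intvalN (x : OF F) : intval (- x) = - intval x.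
Proof. exact: (rmorphN (\val : OF F -> F)). Qed.
Lemma intval0 : intval (0 : OF F) = 0.
Proof. exact: (rmorph0 (\val : OF F -> F)). Qed.
Lemma intval1 : intval (1 : OF F) = 1.
Proof. exact: (rmorph1 (\val : OF F -> F)). Qed.

Lemma primeF_prime (P : finite_prime F) : prime_ideal (primeF P).
Proof.
have [P0 P1 Plin] := fp_ideal P.
have PO : primeF P `<=` O by move=> _ [x _ <-]; exact: intvalP.
split=> //.
- have Padd x y : primeF P x -> primeF P y -> primeF P (x - y).
    move=> [u Pu <-] [v Pv <-]; exists (- 1 * v + u).
      exact: Plin.
    by rewrite intvalD intvalM intvalN intval1 mulN1r addrC.
  split; first by split=> //; exists 0 => //; rewrite intval0.
  move=> a _ Oa [u Pu <-]; exists (IntOF Oa * u); last by rewrite intvalM.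
  by rewrite -[_ * _]addr0; exact: Plin.
- move=> [u Pu u1]; have e : u = 1 by apply: val_inj; exact: etrans u1 (esym intval1).
  by move: P1; rewrite -e => /negP; apply; exact: Pu.
- move=> a b Oa Ob [u Pu uab].
  have e : u = IntOF Oa * IntOF Ob by apply: val_inj; exact: etrans uab (esym (intvalM (IntOF Oa) (IntOF Ob))).
  have := fp_prime (u := IntOF Oa) (v := IntOF Ob); rewrite -e => /(_ P Pu) /orP [h|h].
    by left; exists (IntOF Oa).
  by right; exists (IntOF Ob).
- have [a a0 Pa] := fp_nonzero P; exists (intval a); last by exists a.
  by apply: contra_neq a0 => a0; apply: val_inj; exact: etrans a0 (esym intval0).
Qed.

Hypothesis finO : residually_finite F.

Lemma residue_index (P : finite_prime F) :
  index_le O (primeF P) (residue_card P) /\ index_ge O (primeF P) (residue_card P).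
Proof.
have [fP PO _ _ P0] := primeF_prime P.
pose Q := {ideal_quot (fp_pred P : {pred OF F})}.
have QE (x y : OF F) : primeF P (intval x - intval y) -> \pi_Q x = \pi_Q y.
  move=> [u Pu uxy]; apply/eqP; rewrite -Quotient.idealrBE.
  have <- // : u = x - y.
  by apply: val_inj; rewrite [LHS]uxy -intvalN; exact: (esym (intvalD _ _)).
have EQ (x y : OF F) : \pi_Q x = \pi_Q y -> primeF P (intval x - intval y).
  move=> /eqP; rewrite -Quotient.idealrBE => Pxy; by exists (x - y).
have [N [s _ hs]] := finO fP PO P0.
have /choice [f hf] : forall q : Q, exists i : nat,
    (i < size s)%N /\ primeF P (intval (repr q) - nth 0 s i).
  move=> q; have [y ys Py] := hs (intval (repr q)) (intvalP _).
  by exists (index y s); rewrite index_mem nth_index.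
(* Finiteness is what gives [residue_card] its meaning, as [fset_set] of an infinite set is
   empty. *)
have finQ : finite_set [set: Q].
  apply: (@sub_finite_set _ _ (f @^-1` `I_(size s))).
    by move=> q _ /=; case: (hf q).
  apply: finite_preimage; last exact: finite_II.
  move=> q q' _ _ e; rewrite -[q]reprK -[q']reprK; apply: QE.
  have [_ h] := hf q; have [_ h'] := hf q'; rewrite -e in h'.
  by have := fP.1.2 _ _ h h'; rewrite opprB addrA subrK.
have memQ (q : Q) : q \in fset_set [set: Q] by rewrite in_fset_set // in_setT.
split.
  exists [seq intval (repr q) | q <- fset_set [set: Q]].
    by rewrite size_map.
  move=> x Ox; exists (intval (repr (\pi_Q (IntOF Ox)))); first exact: map_f.
  by apply: (EQ (IntOF Ox) _); rewrite reprK.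
exists [seq intval (repr q) | q <- fset_set [set: Q]]; split.
- by rewrite size_map.
- rewrite map_inj_uniq ?fset_uniq // => q q' e.
  by rewrite -[q]reprK -[q']reprK; apply: QE; rewrite e subrr; exact: fP.1.1.
- by move=> _ /mapP [q _ ->]; exact: intvalP.
- by move=> _ _ /mapP [q _ ->] /mapP [q' _ ->] /QE; rewrite !reprK => ->.
Qed.

(** A function of the underlying set, because the lists of primes consist of subsets of [F]. At a
    prime, [residue_index] rules out the default value. *)
Definition ideal_norm (J : set F) : nat := xget 0%N [set N | index_le O J N /\ index_ge O J N].

Lemma ideal_normP (P : finite_prime F) : ideal_norm (primeF P) = residue_card P.
Proof.
have [fP _ _ _ _] := primeF_prime P.
have h := residue_index P; rewrite /ideal_norm.
case: xgetP => [N _ [le ge]|/(_ _ h) //].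
apply/eqP; rewrite eqn_leq (index_ge_le fP.1 ge h.1).
exact: (index_ge_le fP.1 h.2 le).
Qed.

Lemma residue_card_gt0 (P : finite_prime F) : (0 < residue_card P)%N.
Proof.
have [[s ss hs] _] := residue_index P.
have [y ys _] := hs 0 (rpred0 _).
by apply: leq_trans ss; case: s ys {hs}.
Qed.

Hypothesis closedO : stabilizer_integral F.

Lemma invertible_nonzero (J : set F) : invertible J -> exists2 a, a != 0 & J a.
Proof.
move=> [_ [K _ JK]]; apply: contrapT => h.
have : O 1 by exact: ringF1.
rewrite -JK => -[s [hs]]; rewrite big_seq big1 => [/eqP|u /hs [Ju _]].
  by rewrite oner_eq0.
have [->|u0] := eqVneq u.1 0; first by rewrite mul0r.
by case: h; exists u.1.
Qed.

Lemma prime_product_nseq m (P : set F) :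
  iter m (fideal_mul P) O = prime_product (nseq m P).
Proof. by elim: m => //= m ->. Qed.

Lemma fideal_inv_pow_mul (P : set F) m x y : iter m (fideal_mul (fideal_inv P)) O x ->
  prime_product (nseq m P) y -> O (x * y).
Proof.
elim: m x y => [|m IH] x y /=; first exact: ringFM.
move=> hx hy; have fO := (frac_ideal_ringF F).1.
have sK y' : subgroup [set x | O (x * y')].
  split=> [|a c /=]; rewrite /mkset; first by rewrite mul0r; exact: rpred0.
  by rewrite mulrBl; exact: ringFB.
move: x hx; apply: fideal_mul_sub (sK y) _ => u v hu hv /=.
have sK' : subgroup [set y | O (u * v * y)].
  split=> [|a c /=]; rewrite /mkset; first by rewrite mulr0; exact: rpred0.
  by rewrite mulrBr; exact: ringFB.
move: y hy {sK}; apply: fideal_mul_sub sK' _ => p z Pp hz /=.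
by rewrite mulrACA; apply: ringFM; [exact: hu | exact: IH].
Qed.

Section FactoredIdeal.
Variables (R : realType) (e : finite_prime F -> int).

Definition pow_prod (r : seq (finite_prime F)) : set F :=
  \big[@fideal_mul F / O]_(P <- r) fideal_pow (primeF P) (e P).

(* [ps] and [qs] list the primes of the numerator and of the denominator. *)
Lemma pow_prod_factor r : exists ps qs : seq (set F),
  [/\ forall P, P \in ps ++ qs ->
        [/\ prime_ideal P, index_le O P (ideal_norm P) & index_ge O P (ideal_norm P)],
      invertible (pow_prod r),
      forall f x, pow_prod r f -> prime_product qs x -> prime_product ps (f * x),
      (0 < \prod_(P <- ps) ideal_norm P)%N /\ (0 < \prod_(P <- qs) ideal_norm P)%N &
      ln ((\prod_(P <- ps) ideal_norm P)%:R : R) - ln (\prod_(P <- qs) ideal_norm P)%:R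
        = \sum_(P <- r) ln (residue_card P)%:R * (e P)%:~R].
Proof.
elim: r => [|P r [ps [qs [hprime iI hmul [ps0 qs0] hln]]]].
  exists [::], [::]; rewrite /pow_prod !big_nil; split=> //.
  - exact: invertible_ringF.
  - by move=> f x; exact: ringFM.
  - by rewrite subrr.
have hP := primeF_prime P; have NP := ideal_normP P; have NP0 := residue_card_gt0 P.
have hps Q : Q \in ps -> prime_ideal Q.
  by move=> Qps; have [] := hprime Q; rewrite // mem_cat Qps.
have fps := prime_product_frac hps.
have fqs : frac_ideal (prime_product qs).
  by apply: prime_product_frac => Q Qqs; have [] := hprime Q; rewrite // mem_cat Qqs orbT.
have Nprod m : \prod_(Q <- nseq m (primeF P)) ideal_norm Q = (residue_card P ^ m)%N.
  by rewrite big_nseq NP iter_muln_1.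
have lnN m (k : nat) : (0 < k)%N -> ln ((residue_card P ^ m * k)%:R : R) =
    ln (residue_card P)%:R * m%:R + ln k%:R.
  move=> k0; rewrite natrM lnM ?posrE ?ltr0n ?expn_gt0 ?NP0 // natrX lnXn ?ltr0n //.
  by rewrite mulr_natr.
have prime_nseq m Q : Q \in nseq m (primeF P) -> 
    [/\ prime_ideal Q, index_le O Q (ideal_norm Q) & index_ge O Q (ideal_norm Q)].
  move=> /nseqP [-> _]; rewrite NP; have [? ?] := residue_index P; by split.
rewrite /pow_prod big_cons; case eP: (e P) => [m|m].
  exists (nseq m (primeF P) ++ ps), qs; split.
  - by move=> Q; rewrite -catA mem_cat => /orP [/prime_nseq|/hprime].
  - rewrite /= prime_product_nseq; apply: invertible_mul => //.
    by apply: invertible_prime_product => // Q /prime_nseq [].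
  - move=> f x hf hx; rewrite prime_product_cat; last first.
      by move=> Q; rewrite mem_cat => /orP [/prime_nseq []|/hps].
    have fX : frac_ideal (prime_product (nseq m (primeF P))).
      by apply: prime_product_frac => Q /prime_nseq [].
    have fXps := frac_ideal_mul (prime_product ps) fX.
    move: f hf; rewrite /= prime_product_nseq.
    apply: (@fideal_mul_sub _ _ _ [set f | fideal_mul (prime_product _) _ (f * x)]).
      split=> [|a c /=]; rewrite /mkset; first by rewrite mul0r; exact: fXps.1.1.
      by rewrite mulrBl; exact: fXps.1.2.
    move=> u v hu hv /=; rewrite -mulrA; apply: fideal_mul_mem => //; exact: hmul.
  - by rewrite big_cat Nprod /= muln_gt0 expn_gt0 NP0.
  - rewrite big_cat Nprod /= lnN // big_cons eP -hln; ring.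
(* [Negz m] stands for [-(m+1)], so [m.+1] copies of [P] go to the denominator. *)
exists ps, (nseq m.+1 (primeF P) ++ qs); split.
- move=> Q; rewrite mem_cat => /orP [Qps|]; first by apply: hprime; rewrite mem_cat Qps.
  rewrite mem_cat => /orP [/prime_nseq //|Qqs].
  by apply: hprime; rewrite mem_cat Qqs orbT.
- apply: invertible_mul => //; rewrite /fideal_pow; elim: m.+1 => [|k IH] /=.
    exact: invertible_ringF.
  by apply: invertible_mul => //; exact: invertible_prime_inv.
- move=> f x hf; rewrite prime_product_cat; last first.
    move=> Q; rewrite mem_cat => /orP [/prime_nseq []//|Qqs].
    by have [] := hprime Q; rewrite // mem_cat Qqs orbT.
  move: x; apply: (@fideal_mul_sub _ _ _ [set x | prime_product ps (f * x)]).
    split=> [|a c /=]; rewrite /mkset; first by rewrite mulr0; exact: fps.1.1.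
    by rewrite mulrBr; exact: fps.1.2.
  move=> p q hp hq /=; move: f hf.
  apply: (@fideal_mul_sub _ _ _ [set f | prime_product ps (f * _)]).
    split=> [|a c /=]; rewrite /mkset; first by rewrite mul0r; exact: fps.1.1.
    by rewrite mulrBl; exact: fps.1.2.
  move=> u v hu hv /=; rewrite mulrACA; apply: fps.2; last exact: hmul.
  exact: fideal_inv_pow_mul hu hp.
- by rewrite big_cat Nprod /= muln_gt0 expn_gt0 NP0.
- rewrite big_cat Nprod /= lnN // big_cons eP -hln NegzE rmorphN /=; ring.
Qed.
End FactoredIdeal.
End FinitePrimes.

(** * Embeddings and norms *)

Local Notation normc := complex.ComplexField.Normc.normc.

Section Embeddings.
Variables (R : realType) (F : fieldExtType rat).

Lemma rmorph_in_alg (K : fieldType) (s : {rmorphism F -> K}) (a : rat) :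
  s (in_alg F a) = ratr a.
Proof. exact: (fmorph_eq_rat (s \o in_alg F)). Qed.

Lemma rmorph_horner_in_alg (K : fieldType) (s : {rmorphism F -> K}) (p : {poly rat}) x :
  s (map_poly (in_alg F) p).[x] = (map_poly ratr p).[s x].
Proof.
rewrite -horner_map -map_poly_comp; congr horner; apply: eq_map_poly => a.
exact: rmorph_in_alg.
Qed.

Lemma exists_primitive_element :
  exists theta : F, forall x, exists p : {poly rat}, x = (map_poly (in_alg F) p).[theta].
Proof.
exists (separable_generator 1 {:F}%AS) => x.
apply/Fadjoin1_polyP; rewrite -eq_adjoin_separable_generator ?memvf ?sub1v //.
by apply/separableP => y _; apply: pcharf0_separable => p; rewrite pchar_lalg pchar_num.
Qed.

(** Complex embeddings correspond to the roots of the minimal polynomial of a primitive element,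
    which are distinct by separability. *)
Lemma exists_embeddings (theta : F) (n : nat) :
    (forall x, exists p : {poly rat}, x = (map_poly (in_alg F) p).[theta]) ->
    \dim {:F} = n.+1 ->
  exists rs : seq R[i], [/\ uniq rs, size rs = n.+1,
    forall s : {rmorphism F -> R[i]}, s theta \in rs &
    forall z, z \in rs -> exists s : {rmorphism F -> R[i]}, s theta = z].
Proof.
move=> gen dimF.
have [mu muE] : exists mu, minPoly 1 theta = map_poly (in_alg F) mu.
  exact/polyOver1P/minPolyOver.
pose p : {poly R[i]} := map_poly ratr mu.
have mu_root (q : {poly rat}) : (map_poly (in_alg F) q).[theta] = 0 -> mu %| q.
  move=> q0; rewrite -(dvdp_map (in_alg F)) -muE; apply: minPoly_dvdp; last exact/rootP.
  by apply/polyOver1P; exists q.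
have [rs Drs] := closed_field_poly_normal p.
have mu_monic : mu \is monic.
  by rewrite -(map_monic (in_alg F)) -muE monic_minPoly.
have p_monic : p \is monic by exact: monic_map.
rewrite (monicP p_monic) scale1r in Drs.
have sz : size rs = n.+1.
  apply: succn_inj; rewrite -dimF -(size_prod_XsubC rs id) -Drs size_map_poly.
  rewrite -(size_map_poly (in_alg F)) -muE size_minPoly.
  suff -> : fullv = <<1; theta>>%VS by rewrite dim_Fadjoin dimv1 muln1.
  by apply/eqP; rewrite eqEsubv subvf andbT; apply/subvP => x _; exact/Fadjoin1_polyP.
exists rs; split=> //.
- have : separable_element 1%AS theta.
    by apply: pcharf0_separable => q; rewrite pchar_lalg pchar_num.
  rewrite /separable_element muE separable_map -(separable_map (@ratr R[i])).
  by rewrite -/p Drs separable_prod_XsubC.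
- move=> s; rewrite -root_prod_XsubC -Drs; apply/rootP.
  by rewrite -rmorph_horner_in_alg -muE minPolyxx rmorph0.
move=> z; rewrite -root_prod_XsubC -Drs => /rootP pz.
have /choice [g hg] := gen.
(* The value at [z] depends only on the value at [theta], since the minimal polynomial divides the
   difference. So any choice [g] of polynomials defines the embedding. *)
have wd (q q' : {poly rat}) : (map_poly (in_alg F) q).[theta] =
    (map_poly (in_alg F) q').[theta] -> (map_poly ratr q).[z] = (map_poly ratr q').[z].
  move=> e; apply/eqP; rewrite -subr_eq0 -hornerN -hornerD -rmorphN -rmorphD.
  have /mu_root /dvdpP [u ->] : (map_poly (in_alg F) (q - q')).[theta] = 0.
    by rewrite rmorphB hornerD hornerN e subrr.
  by rewrite rmorphM hornerM pz mulr0.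
pose s x : R[i] := (map_poly ratr (g x)).[z].
have sD : zmod_morphism s.
  move=> x y; rewrite /s -hornerN -hornerD -rmorphN -rmorphD; apply: wd.
  by rewrite -hg rmorphB hornerD hornerN -!hg.
have sM : monoid_morphism s.
  split.
    rewrite /s -[RHS](hornerC 1 z) -[1%:P](rmorph1 (map_poly (@ratr R[i]))); apply: wd.
    by rewrite -hg rmorph1 hornerC.
  move=> x y; rewrite /s -hornerM -rmorphM; apply: wd.
  by rewrite -hg rmorphM hornerM -!hg.
pose sA := GRing.isZmodMorphism.Build F R[i] s sD.
pose sMM := GRing.isMonoidMorphism.Build F R[i] s sM.
pose S : {rmorphism F -> R[i]} := HB.pack s sA sMM.
exists S => /=; rewrite /s -[RHS]hornerX -(map_polyX (@ratr R[i])); apply: wd.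
by rewrite -hg map_polyX hornerX.
Qed.

Variable S : infinite_primes R F.

(** All embeddings into [R[i]]: each complex infinite prime is counted twice, for the chosen
    embedding and for its conjugate. *)
Definition places : finType := ('I_(r1 S) + ('I_(r2 S) + 'I_(r2 S)))%type.

Definition real_embC (i : 'I_(r1 S)) : {rmorphism F -> R[i]} := real_complex R \o real_emb i.
Definition cplx_embJ (j : 'I_(r2 S)) : {rmorphism F -> R[i]} := conjc \o cplx_emb j.

Definition tau (t : places) : {rmorphism F -> R[i]} :=
  match t with
  | inl i => real_embC i
  | inr (inl j) => cplx_emb j
  | inr (inr j) => cplx_embJ j
  end.

Definition conj_place (t : places) : places :=
  match t with
  | inl i => inl i
  | inr (inl j) => inr (inr j)
  | inr (inr j) => inr (inl j)
  end.

Lemma conj_placeK : involutive conj_place. Proof. by case=> [|[]]. Qed.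

Lemma tau_conj t x : tau (conj_place t) x = conjc (tau t x).
Proof.
case: t => [i|[j|j]]; [exact: (esym (conjc_real _)) | by [] | exact: (esym (conjcK _))].
Qed.

Lemma tau_inj t t' : tau t =1 tau t' -> t = t'.
Proof.
have RC (i : 'I_(r1 S)) (j : 'I_(r2 S)) : ~ (forall x, real_embC i x = cplx_emb j x).
  move=> h; have [x] := @cplx_emb_nonreal _ _ S j; rewrite -h /=.
  by rewrite eqxx.
have RJ (i : 'I_(r1 S)) (j : 'I_(r2 S)) : ~ (forall x, real_embC i x = cplx_embJ j x).
  move=> h; apply: (RC i j) => x; rewrite -[RHS]conjcK -[conjc (_ x)]h.
  exact: (esym (conjc_real _)).
have CJ (j j' : 'I_(r2 S)) : ~ (forall x, cplx_emb j x = cplx_embJ j' x).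
  move=> h; have e : j = j' by apply: (@cplx_emb_inj _ _ S); right.
  have [x] := @cplx_emb_nonreal _ _ S j; move: (h x); rewrite -e /=.
  case: (cplx_emb j x) => a b /= [] /eqP; rewrite -subr_eq0 opprK -mulr2n.
  by rewrite mulrn_eq0 /= => ->.
case: t t' => [i|[j|j]] [i'|[j'|j']] h //=.
- by congr inl; apply: (@real_emb_inj _ _ S) => x; have [] := h x.
- by case: (RC _ _ h).
- by case: (RJ _ _ h).
- by case: (RC i' j) => x; rewrite -h.
- by congr (inr (inl _)); apply: (@cplx_emb_inj _ _ S); left.
- by case: (CJ _ _ h).
- by case: (RJ i' j) => x; rewrite -h.
- by case: (CJ j' j) => x; rewrite -h.
- congr (inr (inr _)); apply: (@cplx_emb_inj _ _ S); left => x.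
  by apply: (inv_inj (@conjcK R)); exact: h.
Qed.

Lemma tau_surj (s : {rmorphism F -> R[i]}) : exists t, s =1 tau t.
Proof.
have [h|h] := pselect (exists x, complex.Im (s x) != 0).
  have [j [e|e]] := @cplx_emb_surj _ _ S s h; first by exists (inr (inl j)).
  by exists (inr (inr j)).
have im0 x : complex.Im (s x) = 0.
  by apply/eqP; apply: contrapT => /negP ?; apply: h; exists x.
have sE x : s x = (complex.Re (s x))%:C%C.
  by case: (s x) (im0 x) => a b /= ->.
pose f x := complex.Re (s x).
have fD : zmod_morphism f.
  by move=> x y; apply: (@complexI R); rewrite rmorphB /= -!sE rmorphB.
have fM : monoid_morphism f.
  split; first by rewrite /f rmorph1.
  by move=> x y; apply: (@complexI R); rewrite rmorphM /= -!sE rmorphM.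
pose fA := GRing.isZmodMorphism.Build F R f fD.
pose fMM := GRing.isMonoidMorphism.Build F R f fM.
pose G : {rmorphism F -> R} := HB.pack f fA fMM.
have [i e] := @real_emb_surj _ _ S G; exists (inl i) => x.
by rewrite sE /= -e.
Qed.

Variables (n : nat) (b : n.+1.-tuple F).
Hypothesis basis_b : basis_of fullv b.

Lemma dim_eq : \dim {:F} = n.+1. Proof. exact: size_basis basis_b. Qed.

(** The formula [r1 + 2 r2 = n]: evaluation at a primitive element matches places with the roots of
    its minimal polynomial. *)
Lemma card_places : #|places| = n.+1.
Proof.
have [theta gen] := exists_primitive_element.
have [rs [urs srs inrs outrs]] := exists_embeddings gen dim_eq.
pose ts := [seq tau t theta | t : places].
have uts : uniq ts.
  rewrite map_inj_uniq ?enum_uniq // => t t' e; apply: tau_inj => x.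
  by have [p ->] := gen x; rewrite !rmorph_horner_in_alg e.
have -> : #|places| = size ts by rewrite size_map cardT.
rewrite -srs; apply/eqP; rewrite eqn_leq !uniq_leq_size //.
  move=> z /outrs [s <-]; have [t e] := tau_surj s.
  by apply/mapP; exists t; rewrite ?mem_enum.
by move=> _ /mapP [t _ ->].
Qed.

Definition place (i : 'I_n.+1) : places := enum_val (cast_ord (esym card_places) i).

Lemma place_bij : bijective place.
Proof.
exists (fun t => cast_ord card_places (enum_rank t)) => [i|t].
  by rewrite /place enum_valK cast_ordKV.
by rewrite /place cast_ordK enum_rankK.
Qed.

Lemma prod_places (f : places -> R[i]) : \prod_t f t = \prod_i f (place i).
Proof. by rewrite (reindex place) //; exact: onW_bij place_bij. Qed.

Lemma sum_places (f : places -> R[i]) : \sum_t f t = \sum_i f (place i).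
Proof. by rewrite (reindex place) //; exact: onW_bij place_bij. Qed.

Definition emb_mx : 'M[R[i]]_n.+1 := \matrix_(k, i) tau (place i) b`_k.

Lemma tau_vec_of c i : tau (place i) (vec_of b c) = (map_mx ratr c *m emb_mx) 0 i.
Proof.
rewrite /vec_of rmorph_sum !mxE; apply: eq_bigr => k _.
rewrite !mxE -[_ *: _]mulr1 -scalerAl -mulr_algl rmorphM mulr1.
by rewrite rmorph_in_alg.
Qed.

(** The Vandermonde matrix of the distinct conjugates of a primitive element factors through
    [emb_mx]. *)
Lemma emb_mx_unit : emb_mx \in unitmx.
Proof.
have [theta gen] := exists_primitive_element.
pose a : 'rV[R[i]]_n.+1 := \row_i tau (place i) theta.
have VE : Vandermonde n.+1 a =
    map_mx ratr (\matrix_j coords b (theta ^+ j)) *m emb_mx.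
  apply/matrixP => j i; rewrite !mxE -rmorphXn -(coordsK basis_b (theta ^+ j)).
  rewrite tau_vec_of !mxE; apply: eq_bigr => k _; rewrite !mxE.
  by rewrite ?coordsK.
have : \det (Vandermonde n.+1 a) != 0.
  rewrite det_Vandermonde; apply/prodf_neq0 => i _; apply/prodf_neq0 => j ij.
  rewrite !mxE subr_eq0; apply: contraTneq ij => e.
  suff -> : i = j by rewrite ltnn.
  apply: (bij_inj place_bij); apply: tau_inj => x.
  by have [p ->] := gen x; rewrite !rmorph_horner_in_alg e.
by rewrite VE det_mulmx unitmxE unitfE; apply: contraNneq => ->; rewrite mulr0.
Qed.

(** [emb_mx] diagonalizes multiplication by [f], with the conjugates of [f] as eigenvalues. Norm and
    trace in terms of embeddings follow. *)
Lemma emb_mx_mul f : emb_mx *m diag_mx (\row_i tau (place i) f) =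
  map_mx ratr (mul_mx b f) *m emb_mx.
Proof.
apply/matrixP => k i; rewrite mul_mx_diag !mxE -rmorphM.
rewrite -(vec_of_delta b k) -(vec_of_mul basis_b) tau_vec_of -rowE.
by rewrite !mxE; apply: eq_bigr => l _; rewrite !mxE.
Qed.

Lemma mul_mx_diag_emb f :
  map_mx ratr (mul_mx b f) = emb_mx *m diag_mx (\row_i tau (place i) f) *m invmx emb_mx.
Proof. by rewrite emb_mx_mul mulmxK // emb_mx_unit. Qed.

Lemma det_mul_mx f : ratr (\det (mul_mx b f)) = \prod_t tau t f.
Proof.
have W0 := emb_mx_unit; rewrite unitmxE unitfE in W0.
apply: (mulIf W0); rewrite -det_map_mx -det_mulmx -emb_mx_mul det_mulmx mulrC.
rewrite det_diag prod_places; congr (_ * _); apply: eq_bigr => i _.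
by rewrite mxE.
Qed.

Lemma trace_mul_mx f : ratr (\tr (mul_mx b f)) = \sum_t tau t f.
Proof.
rewrite -trace_map_mx mul_mx_diag_emb -mulmxA mxtrace_mulC mulmxKV ?emb_mx_unit //.
by rewrite mxtrace_diag sum_places; apply: eq_bigr => i _; rewrite mxE.
Qed.

Lemma det_emb_mx : \det emb_mx ^+ 2 = ratr (\det (trace_mx b)).
Proof.
rewrite expr2 -{2}det_tr -det_mulmx -det_map_mx; congr (\det _).
apply/matrixP => k l; rewrite [RHS]mxE.
transitivity (ratr (trace_mx b k l) : R[i]); last by [].
rewrite [LHS]mxE [X in ratr X]mxE trace_mul_mx sum_places; apply: eq_bigr => i _.
by rewrite !mxE rmorphM.
Qed.

Lemma normc_ratr (a : rat) : normc (ratr a : R[i]) = `|ratr a|.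
Proof.
have -> : (ratr a : R[i]) = (ratr a)%:C%C.
  by apply/esym; exact: (fmorph_eq_rat (real_complex R \o ratr)).
by rewrite /normc /= expr0n /= addr0 sqrtr_sqr.
Qed.

Lemma normc_prod (I : finType) (f : I -> R[i]) : normc (\prod_i f i) = \prod_i normc (f i).
Proof.
apply: (big_rec2 (fun x y => normc x = y)) => [|i y x _ <-].
  by rewrite /normc /= expr0n /= addr0 expr1n sqrtr1.
exact: complex.ComplexField.Normc.normcM.
Qed.

Lemma prod_normc_tau f : \prod_t normc (tau t f) = ratr `|\det (mul_mx b f)|.
Proof.
by rewrite -normc_prod -det_mul_mx normc_ratr ratr_norm.
Qed.
End Embeddings.

(** * The metric of a divisor *)

Section Metric.
Variables (R : realType) (F : fieldExtType rat) (S : infinite_primes R F).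
Variable D : arakelov_divisor S.
Local Notation T := (places S).

(** The factor 2 at complex primes in [normsq] becomes the sum over the two conjugate places, each
    of weight [e^(-x)]; the product of all weights is then [e^(-2 deg)] of the infinite part. *)
Definition weight (t : T) : R :=
  match t with
  | inl i => expR (- 2 * coef_real D i)
  | inr (inl j) | inr (inr j) => expR (- coef_cplx D j)
  end.

Lemma weight_gt0 t : 0 < weight t. Proof. by case: t => [|[]] *; exact: expR_gt0. Qed.

Lemma weight_conj t : weight (conj_place t) = weight t. Proof. by case: t => [|[]]. Qed.

Lemma sum_placesE (V : nmodType) (f : T -> V) :
  \sum_t f t = \sum_i f (inl i) + (\sum_j f (inr (inl j)) + \sum_j f (inr (inr j))).
Proof. by rewrite !big_sumType. Qed.

Lemma normc_real (x : R) : normc (x%:C)%C = `|x|.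
Proof. by rewrite /normc /= expr0n /= addr0 sqrtr_sqr. Qed.

Lemma normc_conj (x : R[i]) : normc (conjc x) = normc x.
Proof. by case: x => a b; rewrite /normc /= sqrrN. Qed.

Lemma normsqE f : normsq D (mink_emb S f) = \sum_t weight t * normc (tau t f) ^+ 2.
Proof.
rewrite /normsq sum_placesE /=; congr (_ + _).
  apply: eq_bigr => i _; rewrite mxE mulrC; congr (_ * _ ^+ 2).
  exact: (esym (normc_real _)).
rewrite -big_split; apply: eq_bigr => j _ /=.
by rewrite mxE normc_conj; ring.
Qed.

Definition adeg_inf : R := \sum_i coef_real D i + \sum_j coef_cplx D j.

Lemma prod_weight : \prod_t weight t = expR (- 2 * adeg_inf).
Proof.
rewrite !big_sumType /= -!expR_sum -!expRD; congr expR.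
by rewrite /adeg_inf !sumrN -mulr_sumr; ring.
Qed.

(** Real coordinates in which [normsq] is a plain sum of squares. The two places of a conjugate pair
    carry the real and the imaginary part. *)
Definition coord_at (t : T) (f : F) : R :=
  match t with
  | inl i => expR (- coef_real D i) * real_emb i f
  | inr (inl j) => Num.sqrt 2 * expR (- coef_cplx D j / 2) * complex.Re (cplx_emb j f)
  | inr (inr j) => Num.sqrt 2 * expR (- coef_cplx D j / 2) * complex.Im (cplx_emb j f)
  end.

Lemma coord_atB t f g : coord_at t (f - g) = coord_at t f - coord_at t g.
Proof.
by case: t => [i|[j|j]] /=; rewrite rmorphB /= ?raddfB mulrBr.
Qed.

Lemma normsq_coord f : normsq D (mink_emb S f) = \sum_t coord_at t f ^+ 2.
Proof.
rewrite /normsq sum_placesE /=; congr (_ + _).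
  apply: eq_bigr => i _; rewrite mxE exprMn -expRM_natl real_normK ?num_real // mulrC.
  by congr (expR _ * _); ring.
rewrite -big_split; apply: eq_bigr => j _ /=.
rewrite mxE !exprMn sqr_sqrtr ?ler0n // -expRM_natl.
have -> : 2%:R * (- coef_cplx D j / 2) = - coef_cplx D j by field.
case: (cplx_emb j f) => x y; rewrite /normc /= sqr_sqrtr ?addr_ge0 ?sqr_ge0 //.
ring.
Qed.

Lemma mink_embD f g : mink_emb S f + mink_emb S g = mink_emb S (f + g).
Proof.
by rewrite /mink_emb; congr pair; apply/rowP => i; rewrite !mxE rmorphD.
Qed.

Lemma Re_normc (x y : R[i]) :
  normc (x + y) ^+ 2 - normc x ^+ 2 - normc y ^+ 2 = 2 * complex.Re (x * conjc y).
Proof.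
case: x y => a b [c d]; rewrite /normc /= !sqr_sqrtr ?addr_ge0 ?sqr_ge0 //.
by ring.
Qed.

(** Polarization gives real parts of the summands; conjugate places contribute conjugate terms of
    equal weight, so the real part may be dropped in the total. *)
Lemma inner_mink f g : ((inner (normsq D) (mink_emb S f) (mink_emb S g))%:C)%C =
  \sum_t (weight t)%:C%C * (tau t f * conjc (tau t g)).
Proof.
pose z (t : T) := tau t f * conjc (tau t g).
have -> : inner (normsq D) (mink_emb S f) (mink_emb S g) =
    \sum_t weight t * complex.Re (z t).
  rewrite /inner mink_embD !normsqE -!sumrB mulr_suml; apply: eq_bigr => t _.
  rewrite rmorphD -!mulrBr Re_normc -/(z t).
  by field.
have conj_sum : \sum_t (weight t)%:C%C * conjc (z t) = \sum_t (weight t)%:C%C * z t.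
  rewrite (reindex_inj (inv_inj (@conj_placeK _ _ S))); apply: eq_bigr => t _.
  by rewrite weight_conj /z !tau_conj rmorphM /= !conjcK.
rewrite rmorph_sum /=.
transitivity ((\sum_t (weight t)%:C%C * z t + \sum_t (weight t)%:C%C * conjc (z t)) / 2).
  rewrite -big_split mulr_suml; apply: eq_bigr => t _ /=.
  by rewrite rmorphM /= ReJ_add -mulrDr mulrA.
by rewrite conj_sum -mulr2n -[_ *+ 2]mulr_natr mulfK // pnatr_eq0.
Qed.

Variables (n : nat) (b : n.+1.-tuple F).
Hypothesis basis_b : basis_of fullv b.

(** Arithmetic-geometric mean over the [n+1] places: the terms [weight t * |tau t f|^2] add up to
    [normsq] and multiply to the left-hand side. *)
Lemma normsq_AGM f :
  expR (- 2 * adeg_inf) * (ratr `|\det (mul_mx b f)|) ^+ 2 <=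
  (normsq D (mink_emb S f) / n.+1%:R) ^+ n.+1.
Proof.
rewrite -prod_weight -(prod_normc_tau S basis_b f) -prodrXl -big_split /= normsqE.
have := leif_AGM (A := [set: T]%SET) (E := fun t => weight t * normc (tau t f) ^+ 2).
rewrite cardsT (card_places S basis_b) => h.
have {h}[|h _] := h.
  by move=> t _; rewrite mulr_ge0 ?sqr_ge0 // ltW // weight_gt0.
by move: h; under eq_bigl do rewrite inE; under [in leRHS]eq_bigl do rewrite inE.
Qed.

(** The Gram matrix is [W] times the diagonal of weights times the conjugate transpose of [W], where
    [W] is [C] times [emb_mx]; and [det emb_mx] squares to the discriminant of [b]. *)
Lemma det_gram (C : 'M[rat]_n.+1) (f : 'I_n.+1 -> F) :
  (forall i, f i = vec_of b (row i C)) ->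
  \det (\matrix_(i, j) inner (normsq D) (mink_emb S (f i)) (mink_emb S (f j))) =
  (ratr `|\det C|) ^+ 2 * ratr `|\det (trace_mx b)| * expR (- 2 * adeg_inf).
Proof.
move=> fC; pose W : 'M[R[i]]_n.+1 := \matrix_(i, k) tau (place S basis_b k) (f i).
have WE : W = map_mx ratr C *m emb_mx S basis_b.
  apply/matrixP => i k; rewrite mxE fC tau_vec_of !mxE.
  by apply: eq_bigr => l _; rewrite !mxE.
apply: (@complexI R); rewrite -det_map_mx.
have -> : map_mx (real_complex R)
    (\matrix_(i, j) inner (normsq D) (mink_emb S (f i)) (mink_emb S (f j))) =
    W *m diag_mx (\row_k (weight (place S basis_b k))%:C%C) *m (map_mx conjc W)^T.
  apply/matrixP => i j; rewrite mxE [in LHS]mxE inner_mink (sum_places basis_b) mul_mx_diag.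
  rewrite !mxE; apply: eq_bigr => k _; rewrite !mxE.
  by ring.
rewrite !det_mulmx det_diag det_tr det_map_mx /= mulrAC -sqr_normc.
have -> : \prod_k (\row_k0 (weight (place S basis_b k0))%:C%C) 0 k =
    (expR (- 2 * adeg_inf))%:C%C.
  rewrite -prod_weight rmorph_prod (prod_places basis_b).
  by apply: eq_bigr => k _; rewrite mxE.
have ratrC (a : rat) : ((ratr a : R)%:C)%C = ratr a.
  exact: (fmorph_eq_rat (real_complex R \o ratr)).
rewrite rmorphM [X in _ = X * _]rmorphM rmorphXn /= !ratrC; congr (_ * _).
rewrite WE det_mulmx normrM exprMn det_map_mx -!ratr_norm; congr (_ * _).
by rewrite -normrX det_emb_mx // -ratr_norm.
Qed.
End Metric.

(** * A packing bound for Gaussian sums *)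

Section Packing.
Variable R : realType.

Lemma geometric_sum_le (x : R) m : 0 <= x < 1 -> \sum_(i < m) x ^+ i <= (1 - x)^-1.
Proof.
move=> /andP [x0 x1]; have y0 : 0 < 1 - x by rewrite subr_gt0.
rewrite -(ler_pM2l y0) divff ?gt_eqF // -opprB mulNr -subrX1 opprB.
by rewrite gerDl oppr_le0 exprn_ge0.
Qed.

(** Zigzag numbering of the integers, so that a sum over cells becomes a geometric series indexed by
    naturals. *)
Definition int_code (a : int) : nat := match a with Posz m => m.*2 | Negz m => m.*2.+1 end.

Lemma int_code_inj : injective int_code.
Proof. by move=> [a|a] [b|b] /= h; first [congr Posz; lia | congr Negz; lia | lia]. Qed.

Lemma int_code_floor (z : R) : (int_code (Num.floor z))%:R <= 2 * `|z| + 1.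
Proof.
have /andP [] := floor_itv z; case: (Num.floor z) => m /=.
  rewrite -pmulrn => zl _; have := ler_norm z.
  by rewrite -muln2 natrM; lra.
rewrite NegzE -[m.+1]addn1 PoszD opprD -addrA addNr addr0 rmorphN /= -pmulrn => _ zu.
have := ler_norm (- z); rewrite normrN -muln2 -addn1 natrD natrM; lra.
Qed.

Section Points.
Variables (E : eqType) (T : finType) (X : T -> E -> R) (lambda : R) (s : seq E).
Hypothesis lambda_gt0 : 0 < lambda.
Hypothesis uniq_s : uniq s.
Hypothesis separated : forall x y, x \in s -> y \in s -> x != y ->
  lambda ^+ 2 <= \sum_t (X t x - X t y) ^+ 2.

Let r : R := #|T|.+1%:R.

(* The cells of side [lambda / r] have diameter less than [lambda]. *)
Definition cell (t : T) (x : E) : nat := int_code (Num.floor (r * X t x / lambda)).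

Let r_gt0 : 0 < r. Proof. by rewrite ltr0n. Qed.

Lemma cell_inj : {in s &, forall x y, (forall t, cell t x = cell t y) -> x = y}.
Proof.
move=> x y xs ys h; apply/eqP; apply: contraT => /(separated xs ys).
rewrite leNgt => /negP []; apply: (@le_lt_trans _ _ (\sum_(t : T) (lambda / r) ^+ 2)).
  apply: ler_sum => t _; have := int_code_inj (h t).
  have := floor_itv (r * X t x / lambda); have := floor_itv (r * X t y / lambda).
  move=> + + e; rewrite e rmorphD /=; set u := _ / _; set v := _ / _ => hu hv.
  have -> : X t x - X t y = (v - u) * (lambda / r).
    by rewrite /u /v; field; rewrite !gt_eqF.
  rewrite exprMn ler_piMl ?sqr_ge0 // -real_normK ?num_real // expr_le1 //.
  by rewrite ler_norml; apply/andP; move: hu hv => /andP [? ?] /andP [? ?]; split; lra.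
rewrite sumr_const -[_ *+ _]mulr_natr -[ltRHS]mulr1 exprMn -mulrA ltr_pM2l ?exprn_gt0 //.
rewrite exprVn mulrC ltr_pdivrMr ?exprn_gt0 // mul1r -natrX ltr_nat.
rewrite (_ : #|_| = #|T|); last exact: eq_card.
by rewrite -mulnn; nia.
Qed.

Variable c : R.
Hypothesis c_gt0 : 0 < c.

Definition packing_ratio : R := expR (- (c / (2 * r))).
Definition packing_factor : R := expR (c / (2 * r) + c / 4).

(** With [y = X t x / lambda], the square [(|y| - 1/2)^2 >= 0] gives [y^2 >= |y| - 1/4], and
    [int_code_floor] gives [|y| >= (cell - 1) / (2 r)]. The Gaussian is thus replaced by geometric
    decay in the cell number. *)
Lemma gauss_cell t x :
  expR (- c * (X t x / lambda) ^+ 2) <= packing_factor * packing_ratio ^+ cell t x.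
Proof.
rewrite /packing_factor /packing_ratio -expRM_natl -expRD ler_expR.
have := int_code_floor (r * X t x / lambda); rewrite -/(cell t x).
set y := X t x / lambda; set e := (cell t x)%:R.
have -> : r * X t x / lambda = r * y by rewrite /y mulrA.
rewrite normrM (gtr0_norm r_gt0) => he.
have h1 : `|y| - 1 / 4 <= y ^+ 2 
  by rewrite -[leRHS]real_normK ?num_real //; have := sqr_ge0 (`|y| - 1 / 2); lra.
have h2 : e / (2 * r) - 1 / (2 * r) <= `|y|.
  rewrite -mulrBl ler_pdivrMr ?mulr_gt0 //.
  by move: he; rewrite [_ * (2 * r)]mulrC -mulrA; set ry := r * _; lra.
have -> : c / (2 * r) + c / 4 + e * - (c / (2 * r)) =
    - c * (e / (2 * r) - 1 / (2 * r) - 1 / 4) by field; rewrite gt_eqF.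
rewrite !mulNr lerN2 ler_pM2l //; apply: le_trans h1.
by rewrite lerD2r.
Qed.

Definition packing_const : R := (packing_factor / (1 - packing_ratio)) ^+ #|T|.

(** Distinct points have distinct cell vectors, so the sum is at most one over all cell vectors,
    which factors into [#|T|] geometric series. The bound involves neither [lambda] nor [s]. *)
Lemma packing_sum :
  \sum_(x <- s) expR (- c * (\sum_t X t x ^+ 2) / lambda ^+ 2) <= packing_const.
Proof.
have ratio01 : 0 <= packing_ratio < 1.
  by rewrite expR_ge0 expR_lt1 oppr_lt0 divr_gt0 // mulr_gt0.
(* A common bound on the cell numbers makes the index set of cell vectors finite. *)
pose M := (\max_(x <- s) \max_t cell t x)%N.
have leM x t : x \in s -> (cell t x < M.+1)%N.
  move=> xs; rewrite ltnS /M (big_rem x xs) /= leq_max; apply/orP; left.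
  exact: (leq_bigmax t).
pose code x : {ffun T -> 'I_M.+1} := [ffun t => inord (cell t x)].
have code_inj : {in s &, injective code}.
  move=> x y xs ys /ffunP h; apply: cell_inj => // t.
  by have /(congr1 val) := h t; rewrite !ffunE /= !inordK ?leM.
pose h (phi : {ffun T -> 'I_M.+1}) := \prod_t (packing_factor * packing_ratio ^+ phi t).
have h0 phi : 0 <= h phi.
  by apply: prodr_ge0 => t _; rewrite mulr_ge0 ?expR_ge0 // exprn_ge0 ?expR_ge0.
apply: (@le_trans _ _ (\sum_(x <- s) h (code x))).
  rewrite big_seq [leRHS]big_seq; apply: ler_sum => x xs.
  rewrite -mulrA mulr_suml mulr_sumr expR_sum; apply: ler_prod => t _.
  rewrite expR_ge0 ffunE inordK ?leM //=.
  by rewrite -exprVn -exprMn; exact: gauss_cell.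
rewrite -(big_map code xpredT h) big_uniq ?map_inj_in_uniq //=.
apply: (@le_trans _ _ (\sum_phi h phi)).
  rewrite [leRHS](bigID [in map code s]) /= lerDl sumr_ge0 //.
rewrite /h -(bigA_distr_bigA (fun (t : T) (i : 'I_M.+1) =>
  packing_factor * packing_ratio ^+ i)) prodr_const /packing_const.
rewrite lerXn2r ?nnegrE ?sumr_ge0 //.
- by move=> i _; rewrite mulr_ge0 ?expR_ge0 // exprn_ge0 ?expR_ge0.
- by rewrite mulr_ge0 ?expR_ge0 // invr_ge0 subr_ge0 ltW //; case/andP: ratio01.
- by rewrite -mulr_sumr ler_pM2l ?expR_gt0 //; exact: geometric_sum_le.
Qed.
End Points.
End Packing.

(** * Lower bounds for norms and covolumes *)

Section MinkowskiLattice.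
Variables (R : realType) (F : fieldExtType rat) (n : nat) (b : n.+1.-tuple F).
Hypothesis basis_b : basis_of fullv b.
Hypothesis integral_b : forall i : 'I_n.+1, b`_i \in @ring_int F.
Variable d : nat.
Hypothesis d_gt0 : (0 < d)%N.
Hypothesis sub_d : scale d%:R (@ringF F) `<=` lattice b 1%:M.
Variables (S : infinite_primes R F) (D : arakelov_divisor S).

Let kappa : R := (d ^ (n.+1 + n.+1))%:R.
Let q (f : F) : R := normsq D (mink_emb S f).
Let I := aideal D.

Let adeg_fin : R := \sum_(P <- finsupp (coef_fin D)) ln (residue_card P)%:R * (coef_fin D P)%:~R.

Lemma adegE : adeg D = adeg_fin + adeg_inf D.
Proof. by rewrite /adeg /adeg_inf addrA. Qed.

Lemma kappa_gt0 : 0 < kappa.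
Proof. by rewrite ltr0n expn_gt0 d_gt0. Qed.

Lemma ln_ratio_le (x : rat) (u v : nat) : (0 < u)%N -> (0 < v)%N ->
  (u%:R : rat) <= (d ^ (n.+1 + n.+1))%:R * x * v%:R ->
  expR (ln (u%:R : R) - ln v%:R) / kappa <= ratr x.
Proof.
move=> u0 v0; rewrite -(ler_rat R) !rmorphM /= !ratr_nat -/kappa => h.
rewrite ler_pdivrMr ?kappa_gt0 // expRB !lnK ?posrE ?ltr0n //.
by rewrite ler_pdivrMr ?ltr0n // [ratr x * _]mulrC.
Qed.

Lemma aideal_invertible : invertible I.
Proof.
by have [? [? []]] := pow_prod_factor (ringF_residually_finite basis_b integral_b)
  (ringF_stabilizer_integral basis_b integral_b) R
  (fun P => - coef_fin D P) (finsupp (coef_fin D)).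
Qed.

Lemma aideal_norm_lower f : I f -> f != 0 ->
  expR (- adeg_fin) / kappa <= ratr `|\det (mul_mx b f)|.
Proof.
move=> If f0; have [ps [qs [hprime iI hmul [ps0 qs0] hln]]] :=
  pow_prod_factor (ringF_residually_finite basis_b integral_b)
  (ringF_stabilizer_integral basis_b integral_b) R
  (fun P => - coef_fin D P) (finsupp (coef_fin D)).
have -> : - adeg_fin = ln (\prod_(P <- ps) ideal_norm P)%:R - ln (\prod_(P <- qs) ideal_norm P)%:R.
  by rewrite hln /adeg_fin -sumrN; apply: eq_bigr => P _; rewrite rmorphN mulrN.
apply: ln_ratio_le => //; apply: norm_lower => //.
- by move=> P Pps; have [] := hprime P; rewrite // mem_cat Pps.
- by move=> P Pqs; have [] := hprime P; rewrite // mem_cat Pqs orbT.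
- by move=> P Pps; have [] := hprime P; rewrite // mem_cat Pps.
- by move=> P Pqs; have [] := hprime P; rewrite // mem_cat Pqs orbT.
- by move=> x; exact: hmul.
Qed.

Lemma aideal_det_lower C : \det C != 0 -> I = lattice b C ->
  expR (- adeg_fin) / kappa <= ratr `|\det C|.
Proof.
move=> C0 IC; have [ps [qs [hprime iI hmul [ps0 qs0] hln]]] :=
  pow_prod_factor (ringF_residually_finite basis_b integral_b)
  (ringF_stabilizer_integral basis_b integral_b) R
  (fun P => - coef_fin D P) (finsupp (coef_fin D)).
have -> : - adeg_fin = ln (\prod_(P <- ps) ideal_norm P)%:R - ln (\prod_(P <- qs) ideal_norm P)%:R.
  by rewrite hln /adeg_fin -sumrN; apply: eq_bigr => P _; rewrite rmorphN mulrN.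
apply: ln_ratio_le => //; apply: (lattice_lower basis_b integral_b d_gt0 sub_d _ _ _ _ C0 iI IC) => //.
- by move=> P Pps; have [] := hprime P; rewrite // mem_cat Pps.
- by move=> P Pqs; have [] := hprime P; rewrite // mem_cat Pqs orbT.
- by move=> P Pps; have [] := hprime P; rewrite // mem_cat Pps.
- by move=> P Pqs; have [] := hprime P; rewrite // mem_cat Pqs orbT.
Qed.

Lemma q_lower f : adeg D <= 0 -> I f -> f != 0 -> kappa^-1 ^+ 2 <= q f.
Proof.
move=> deg0 If f0; have := normsq_AGM D basis_b f; rewrite -/(q f) => h.
have k1 : kappa^-1 <= 1 by rewrite invf_le1 ?kappa_gt0 // ler1n expn_gt0 d_gt0.
have k0 : 0 < kappa^-1 by rewrite invr_gt0 kappa_gt0.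
have q0 : 0 <= q f.
  by rewrite /q normsqE sumr_ge0 // => t _; rewrite mulr_ge0 ?sqr_ge0 // ltW // weight_gt0.
have low : kappa^-1 ^+ 2 <= (q f / n.+1%:R) ^+ n.+1.
  apply: le_trans h; have := aideal_norm_lower If f0.
  set x := ratr _ => hx.
  have y0 : 0 <= expR (- adeg_fin) / kappa by rewrite divr_ge0 ?expR_ge0 // ltW // kappa_gt0.
  apply: (@le_trans _ _ (expR (- 2 * adeg_inf D) * (expR (- adeg_fin) / kappa) ^+ 2)).
    rewrite exprMn mulrA -expRM_natl -expRD.
    have -> : -2 * adeg_inf D + 2%:R * - adeg_fin = - 2 * adeg D by rewrite adegE; ring.
    by rewrite ler_peMl ?sqr_ge0 // -expR0 ler_expR mulNr oppr_ge0 pmulr_rle0.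
  by rewrite ler_pM2l ?expR_gt0 // lerXn2r // ?nnegrE // (le_trans y0 hx).
(* As [kappa^-1 <= 1], raising to the power [n.+1] only weakens the bound, and both sides become
   [n.+1]-st powers whose bases can be compared. *)
have : (kappa^-1 ^+ 2) ^+ n.+1 <= (q f / n.+1%:R) ^+ n.+1.
  apply: le_trans low; rewrite exprS ger_pMr ?exprn_gt0 //.
  by apply: exprn_ile1; [exact: sqr_ge0 | apply: exprn_ile1; rewrite // ltW].
have qn0 : 0 <= q f / n.+1%:R by rewrite divr_ge0.
rewrite ler_pXn2r ?nnegrE ?sqr_ge0 // => h2.
apply: le_trans h2 _; rewrite ler_pdivrMr ?ltr0n //.
by rewrite ler_peMr // ler1n.
Qed.

Lemma mink_emb_inj : injective (mink_emb S).
Proof.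
move=> x y e; have t : places S := place S basis_b ord0.
apply: (fmorph_inj (tau t)); case: e => /rowP e1 /rowP e2.
case: t => [i|[j|j]] /=.
- by have := e1 i; rewrite !mxE => ->.
- by have := e2 j; rewrite !mxE.
- by have := e2 j; rewrite !mxE => ->.
Qed.

Lemma mink_emb_eq0 f : (mink_emb S f == 0) = (f == 0).
Proof.
have e0 : mink_emb S 0 = 0.
  by rewrite /mink_emb; congr pair; apply/rowP => i; rewrite !mxE rmorph0.
by rewrite -(inj_eq mink_emb_inj) e0.
Qed.

Lemma mink_emb_sum m (f : 'I_m -> F) (k : 'I_m -> int) :
  \sum_i mink_emb S (f i) *~ k i = mink_emb S (\sum_i f i *~ k i).
Proof.
have e0 : mink_emb S 0 = 0 by apply/eqP; rewrite mink_emb_eq0.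
have eD x y : mink_emb S (x + y) = mink_emb S x + mink_emb S y by rewrite mink_embD.
have eN x : mink_emb S (- x) = - mink_emb S x.
  by apply/eqP; rewrite -addr_eq0 mink_embD addNr e0.
have en x (l : nat) : mink_emb S (x *+ l) = mink_emb S x *+ l.
  by elim: l => [|l IH]; rewrite ?mulr0n // !mulrS eD IH.
rewrite (big_morph _ eD e0); apply: eq_bigr => i _.
by case: (k i) => l; rewrite ?NegzE ?mulrNz ?eN -!pmulrn en.
Qed.

Lemma zbasis_free m (bb : 'I_m -> mink_space S) : zbasis (alattice D) bb ->
  exists2 X : m.-tuple F, (forall i : 'I_m, bb i = mink_emb S X`_i) &
    basis_of fullv X /\
    forall x, I x <-> exists k : 'I_m -> int, x = \sum_(i < m) X`_i *~ k i.
Proof.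
move=> [rng inj].
have /choice [f hf] : forall i : 'I_m, exists x, I x /\ mink_emb S x = bb i.
  move=> i; have : alattice D (bb i).
    rewrite rng; exists [ffun j => Posz (j == i)] => //.
    rewrite (bigD1 i) //= ffunE eqxx big1 ?addr0 // => j /negPf ji.
    by rewrite ffunE ji mulr0z.
  by move=> [x Ix e]; exists x.
have [X XE] : exists X : m.-tuple F, forall i : 'I_m, X`_i = f i.
  by exists [tuple f i | i < m] => i; rewrite -tnth_nth tnth_mktuple.
have comb (k : 'I_m -> int) : \sum_i bb i *~ k i = mink_emb S (\sum_i f i *~ k i).
  by rewrite -mink_emb_sum; apply: eq_bigr => i _; case: (hf i) => _ ->.
exists X; first by move=> i; rewrite XE; case: (hf i).
have span x : I x <-> exists k : 'I_m -> int, x = \sum_(i < m) X`_i *~ k i.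
  split=> [Ix|[k ->]].
    have : alattice D (mink_emb S x) by exists x.
    rewrite rng => -[k _]; rewrite comb => /mink_emb_inj <-; exists k.
    by apply: eq_bigr => i _; rewrite XE.
  have : alattice D (\sum_i bb i *~ [ffun i => k i] i) by rewrite rng; exists [ffun i => k i].
  rewrite comb => -[y Iy /mink_emb_inj ey].
  have -> // : \sum_(i < m) X`_i *~ k i = y.
  by rewrite ey; apply: eq_bigr => i _; rewrite XE ffunE.
split=> //; rewrite basisEfree subvf /= size_tuple; apply/andP; split.
  apply/freeP => c hc i.
  have [l l0 [g hg]] := common_denominator c.
  have : \sum_i bb i *~ [ffun i => g i] i = \sum_i bb i *~ [ffun i => 0] i.
    rewrite !comb; congr (mink_emb S _).
    rewrite [RHS]big1; last by move=> j _; rewrite ffunE mulr0z.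
    transitivity ((l%:R : rat) *: \sum_(i < m) c i *: X`_i); last by rewrite hc scaler0.
    rewrite scaler_sumr; apply: eq_bigr => j _.
    by rewrite ffunE scalerA hg scaler_int XE.
  move=> /inj /ffunP /(_ i); rewrite !ffunE => gi0.
  have /eqP := hg i; rewrite gi0 mulf_eq0 pnatr_eq0 => /orP [/eqP l00|/eqP //].
  by rewrite l00 in l0.
rewrite -(size_tuple X); apply: leq_trans (dim_span _).
apply: dimvS; apply/subvP => x _.
have iI := aideal_invertible; have [a a0 Ia] := invertible_nonzero iI.
have [l l0 Ol] := ring_int_scale basis_b (x / a).
have : I (l%:R * (x / a) * a) by exact: iI.1.2.
rewrite -mulrA divfK // => /span [k lx].
have -> : x = (l%:R : rat)^-1 *: (l%:R * x).
  by rewrite mulr_natl -scaler_nat scalerA mulVf ?scale1r // pnatr_eq0 -lt0n.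
rewrite lx memvZ // memv_suml // => i _; rewrite -scaler_int memvZ // memv_span //.
by rewrite mem_nth // size_tuple.
Qed.

(** A nonzero value excludes the default of [xget], so [covol] comes from an actual Z-basis with
    coordinate matrix [C]. By [det_gram] it equals [|det C|] times the root of the discriminant of
    [b] times [e^(-deg)] of the infinite part; [aideal_det_lower] bounds [|det C|]. *)
Lemma covol_lower : covol (normsq D) (alattice D) != 0 ->
  Num.sqrt (ratr `|\det (trace_mx b)|) / kappa * expR (- adeg D) <=
    covol (normsq D) (alattice D).
Proof.
rewrite /covol; case: xgetP => [cv _ [m [bb [hb ->]]] _|]; last by rewrite eqxx.
have [X hX [basX spanX]] := zbasis_free hb.
have e : m = n.+1 by rewrite -(size_basis basX) (size_basis basis_b).
subst m.
pose C : 'M[rat]_n.+1 := \matrix_i coords b X`_i.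
have XC (i : 'I_n.+1) : X`_i = vec_of b (row i C) by rewrite rowK coordsK.
have vecC (c : 'rV[rat]_n.+1) : vec_of b (c *m C) = \sum_i c 0 i *: X`_i.
  rewrite mulmx_sum_row linear_sum; apply: eq_bigr => i _.
  by rewrite linearZ /= -XC.
have C0 : \det C != 0.
  apply/negP => /det0P [c c0 cC]; move/negP: c0; apply.
  have /freeP h := basis_free basX; apply/eqP/rowP => i; rewrite mxE.
  by apply: h; rewrite -vecC cC linear0.
have IC : I = lattice b C.
  apply/seteqP; split=> [x /spanX [k ->]|_ [k _ <-]].
    exists (\row_i k i) => //; rewrite /int_comb vecC; apply: eq_bigr => i _.
    by rewrite !mxE scaler_int.
  apply/spanX; exists (fun i => k 0 i); rewrite /int_comb vecC.
  by apply: eq_bigr => i _; rewrite !mxE scaler_int.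
have -> : \matrix_(i, j) inner (normsq D) (bb i) (bb j) =
    \matrix_(i, j) inner (normsq D) (mink_emb S X`_i) (mink_emb S X`_j) :> 'M[R]_n.+1.
  by apply/matrixP => i j; rewrite !mxE !hX.
rewrite (det_gram D basis_b XC).
have -> : expR (-2 * adeg_inf D) = expR (- adeg_inf D) ^+ 2.
  by rewrite -expRM_natl; congr expR; ring.
have x0 : 0 <= ratr `|\det C| :> R by rewrite ler0q.
have d0 : 0 <= ratr `|\det (trace_mx b)| :> R by rewrite ler0q.
move: x0 d0; set x := ratr `|\det C|; set delta := ratr _ => x0 d0.
have -> : x ^+ 2 * delta * expR (- adeg_inf D) ^+ 2 = (x * expR (- adeg_inf D)) ^+ 2 * delta.
  by ring.
rewrite (sqrtrM delta (sqr_ge0 (x * expR (- adeg_inf D)))) sqrtr_sqr ger0_norm; last exact: mulr_ge0 x0 (expR_ge0 _).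
rewrite adegE opprD expRD.
have -> (u v w z : R) : u / v * (w * z) = (w / v) * z * u by ring.
rewrite ler_wpM2r ?sqrtr_ge0 // ler_pM2r ?expR_gt0 //.
exact: aideal_det_lower.
Qed.

End MinkowskiLattice.

(** * Shortest vectors and theta sums *)

Lemma packing_const_card (R : realType) (T T' : finType) (c : R) :
  #|T| = #|T'| -> packing_const T c = packing_const T' c.
Proof.
by move=> e; rewrite /packing_const /packing_factor /packing_ratio e.
Qed.

Lemma exists_argmin (R : realType) (E : eqType) (f : E -> R) (s : seq E) x : x \in s ->
  exists2 y, y \in s & forall z, z \in s -> f y <= f z.
Proof.
elim: s x => [//|a s IH] x _; case: s IH => [|a' s] IH.
  by exists a; rewrite ?mem_head // => z; rewrite inE => /eqP ->.
have [y ys hy] := IH a' (mem_head _ _).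
have [le|lt] := leP (f a) (f y).
  exists a; first exact: mem_head.
  by move=> z; rewrite inE => /orP [/eqP -> //|/hy]; exact: le_trans.
exists y; first by rewrite inE ys orbT.
by move=> z; rewrite inE => /orP [/eqP ->|/hy //]; exact: ltW.
Qed.

Section GaussianSum.
Variables (R : realType) (F : fieldExtType rat) (S : infinite_primes R F).
Variables (D : arakelov_divisor S) (I : set F).
Hypothesis subgroup_I : subgroup I.
Let q (f : F) : R := normsq D (mink_emb S f).

Lemma q_ge0 f : 0 <= q f.
Proof.
by rewrite /q normsqE sumr_ge0 // => t _; rewrite mulr_ge0 ?sqr_ge0 // ltW // weight_gt0.
Qed.

Lemma q0 : q 0 = 0.
Proof.
rewrite /q normsqE big1 // => t _; rewrite rmorph0 /normc /= expr0n /= addr0 sqrtr0.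
by rewrite expr0n mulr0.
Qed.

Lemma packing_sum_q (lambda c : R) (s : seq F) : 0 < lambda -> 0 < c ->
  (forall f, I f -> f != 0 -> lambda ^+ 2 <= q f) -> uniq s -> {in s, forall f, I f} ->
  \sum_(f <- s) expR (- c * q f / lambda ^+ 2) <= packing_const (places S) c.
Proof.
move=> l0 c0 low us sI.
under eq_bigr => f _ do rewrite /q normsq_coord.
apply: packing_sum => // x y xs ys xy.
under eq_bigr => t _ do rewrite -coord_atB.
by rewrite -normsq_coord; apply: low; [apply: subgroup_I.2; exact: sI | rewrite subr_eq0].
Qed.

Variable lambda0 : R.
Hypothesis lambda0_gt0 : 0 < lambda0.
Hypothesis low : forall f, I f -> f != 0 -> lambda0 ^+ 2 <= q f.

(** Every element with [q f <= rho] contributes at least a fixed [e > 0] to the packing sum, which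
    is bounded. *)
Lemma finite_bounded rho : finite_set [set f | I f /\ q f <= rho].
Proof.
apply: contrapT => /infinite_set_fset h.
pose e := expR (- 1 * rho / lambda0 ^+ 2); pose G : R := packing_const (places S) 1.
have e0 : 0 < e by exact: expR_gt0.
have [B BI cB] := h (Num.bound (`|G| / e)).
have sB : {in B, forall f, I f} by move=> f fB; case: (BI f fB).
have := packing_sum_q lambda0_gt0 ltr01 low (fset_uniq B) sB.
apply/negP; rewrite -ltNge.
apply: (@lt_le_trans _ _ (\sum_(f <- B) e)); last first.
  rewrite big_seq [leRHS]big_seq; apply: ler_sum => f fB; rewrite ler_expR.
  rewrite !mulN1r !mulNr lerN2 ler_pM2r ?invr_gt0 ?exprn_gt0 //.
  by case: (BI f fB).
rewrite big_const_seq count_predT iter_addr_0 -[_ *+ _]mulr_natl -ltr_pdivrMr //.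
apply: le_lt_trans (_ : _ <= `|G| / e) _; first by rewrite ler_pM2r ?invr_gt0 ?ler_norm.
apply: lt_le_trans (archi_boundP _) _; first by rewrite divr_ge0 // ltW.
by rewrite ler_nat.
Qed.

Lemma shortest_exists a : I a -> a != 0 -> exists v,
  [/\ I v, v != 0 & forall f, I f -> f != 0 -> q v <= q f].
Proof.
move=> Ia a0; have fin := finite_bounded (q a).
pose s := [seq f <- fset_set [set f | I f /\ q f <= q a] | f != 0].
have sP f : (f \in s) = (f != 0) && `[< I f /\ q f <= q a >].
  rewrite mem_filter in_fset_set //; congr andb; apply/idP/asboolP; by rewrite inE.
have [|v vs hv] := @exists_argmin _ _ q s a.
  by rewrite sP a0; apply/asboolP.
move: (vs); rewrite sP => /andP [v0 /asboolP [Iv va]].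
exists v; split=> // f If f0; have [fa|/ltW af] := leP (q f) (q a); last exact: le_trans af.
by apply: hv; rewrite sP f0; apply/asboolP.
Qed.

Let c := pi * lambda0 ^+ 2.
Definition gauss_const : R := expR c * packing_const (places S) c.

Section Shortest.
Variable v : F.
Hypotheses (Iv : I v) (v0 : v != 0) (short : forall f, I f -> f != 0 -> q v <= q f).

(* For [u = q f / q v >= 1] one has [q v (u - 1) >= lambda0^2 (u - 1)], which makes
   the bound uniform in [q v]. *)
Lemma gauss_sum_le (s : seq F) : uniq s -> {in s, forall f, I f /\ f != 0} ->
  \sum_(f <- s) expR (- pi * q f) <= gauss_const * expR (- pi * q v).
Proof.
move=> us sI; have qv : lambda0 ^+ 2 <= q v by exact: low.
have l2 : 0 < lambda0 ^+ 2 by rewrite exprn_gt0.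
have qv0 : 0 < q v by exact: lt_le_trans qv.
have sq : Num.sqrt (q v) ^+ 2 = q v by rewrite sqr_sqrtr // ltW.
have c0 : 0 < c by rewrite mulr_gt0 // pi_gt0.
(* The scale is the actual minimum [q v], but the exponent is the fixed [c = pi lambda0^2], so the
   packing constant is independent of [v]. *)
have := @packing_sum_q (Num.sqrt (q v)) c s; rewrite sqrtr_gt0 sq => /(_ qv0 c0 short us).
have sI' : {in s, forall f, I f} by move=> f /sI [].
move=> /(_ sI') h.
rewrite /gauss_const mulrAC; apply: (@le_trans _ _
  (expR c * expR (- pi * q v) * \sum_(f <- s) expR (- c * q f / q v))); last first.
  by rewrite ler_pM2l // mulr_gt0 ?expR_gt0.
rewrite mulr_sumr big_seq [leRHS]big_seq; apply: ler_sum => f /sI [If f0].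
rewrite -!expRD ler_expR /c.
have hf : 1 <= q f / q v by rewrite ler_pdivlMr // mul1r; exact: short.
have -> : - pi * q f = - pi * q v - pi * (q v * (q f / q v - 1)) by field; rewrite gt_eqF.
have -> : pi * lambda0 ^+ 2 + - pi * q v + - (pi * lambda0 ^+ 2) * q f / q v =
  - pi * q v - pi * (lambda0 ^+ 2 * (q f / q v - 1)) by field; rewrite gt_eqF.
rewrite lerD2l lerN2 ler_pM2l ?pi_gt0 // ler_wpM2r ?subr_ge0 //.
Qed.

Let Z : \bar R := (\esum_(f in I) (expR (- pi * q f))%:E)%E.

Lemma theta_le : (Z <= (1 + gauss_const * expR (- pi * q v))%:E)%E.
Proof.
apply: ge_ereal_sup => _ [A [finA AI] <-].
rewrite fsbig_finite //= sumEFin lee_fin.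
set s : seq F := fset_set A.
have us : uniq s by exact: fset_uniq.
have sA f : f \in s -> A f by rewrite in_fset_set // inE.
(* Zero occurs at most once in [s] and accounts for the summand [1]. *)
rewrite (bigID (fun f => f == 0)) /=; apply: lerD.
  rewrite -big_filter; have : (size [seq f <- s | (f == 0)%R] <= 1)%N.
    rewrite size_filter (_ : count _ _ = count_mem (0 : F)%R s) // count_uniq_mem //.
    by case: (_ \in _).
  have : all (fun f => f == 0) [seq f <- s | f == 0] by exact: filter_all.
  case: [seq f <- s | _] => [|f [|//]] /=; first by rewrite big_nil.
  by rewrite andbT => /eqP -> _; rewrite big_seq1 q0 mulr0 expR0.
rewrite -big_filter; apply: gauss_sum_le; first exact: filter_uniq.
by move=> f; rewrite mem_filter => /andP [? /sA /AI].
Qed.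

Lemma theta_ge : ((1 + expR (- pi * q v))%:E <= Z)%E.
Proof.
apply: ereal_sup_ubound; exists [set` [fset 0; v]%fset].
  split; first exact: finite_fset.
  by move=> f /=; rewrite !inE => /orP [/eqP ->|/eqP ->] //; exact: subgroup_I.1.
rewrite fsbig_finite; last exact: finite_fset.
rewrite set_fsetK sumEFin; congr EFin.
rewrite big_fsetU1 /= ?big_seq_fset1 ?q0 ?mulr0 ?expR0 //.
by rewrite inE eq_sym.
Qed.

Lemma gauss_const_gt0 : 0 < gauss_const.
Proof.
have := gauss_sum_le (s := [:: v]) isT; rewrite big_seq1 => h.
have {}h : expR (- pi * q v) <= gauss_const * expR (- pi * q v).
  by apply: h => f; rewrite inE => /eqP ->.
by have := lt_le_trans (expR_gt0 _) h; rewrite pmulr_lgt0 ?expR_gt0.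
Qed.

(** With [t = e^(-pi q v)], the theta sum lies between [1 + t] and [1 + K t], so its logarithm lies
    between [t / 2] and [K t]. The outer logarithm turns these factors into additive constants. *)
Lemma log_theta_bound w : 0 < w ->
  `|ln (1 / w * ln (fine Z)) + pi * q v| <= `|ln w| + `|ln gauss_const| + ln 2.
Proof.
move=> w0; set t := expR (- pi * q v).
have t0 : 0 < t by exact: expR_gt0.
have t1 : t <= 1.
  by rewrite -expR0 ler_expR mulNr oppr_le0 mulr_ge0 ?q_ge0 // ltW // pi_gt0.
have K0 := gauss_const_gt0; set K := gauss_const in K0 *.
(* The two bounds also show that [Z] is finite, so [fine] returns its true value. *)
have [lo hi] : 1 + t <= fine Z /\ fine Z <= 1 + K * t.
  by have := theta_ge; have := theta_le; case: Z => [z| |] //=.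
have Kt : 0 < K * t by rewrite mulr_gt0.
have t2 : 0 < 1 + t by rewrite addr_gt0.
have z0 : 0 < fine Z by exact: lt_le_trans lo.
have hi' : ln (fine Z) <= K * t.
  apply: le_trans (_ : ln (1 + K * t) <= _).
    by rewrite ler_ln ?posrE // addr_gt0.
  by apply: le_ln1Dx; rewrite (lt_trans _ Kt).
have lo' : t / 2 <= ln (fine Z).
  apply: le_trans (_ : ln (1 + t) <= _); last by rewrite ler_ln ?posrE.
  (* The inequality [ln (1 + x) <= x] at [x = - t / (1 + t)] reads [ln (1 + t) >= t / (1 + t)], and
     [t <= 1] makes this at least [t / 2]. *)
  have := @le_ln1Dx R (- (t / (1 + t))).
  have -> : 1 + - (t / (1 + t)) = (1 + t)^-1 by field; rewrite gt_eqF.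
  rewrite lnV ?posrE // lerN2 ltrN2 => h.
  apply: le_trans (h _); last by rewrite ltr_pdivrMr // mul1r ltrDr.
  by rewrite ler_pM2l // lef_pV2 ?posrE //; lra.
have L0 : 0 < ln (fine Z) by apply: lt_le_trans lo'; rewrite divr_gt0.
have lnt : ln t = - (pi * q v) by rewrite /t expRK mulNr.
have hi2 : ln (ln (fine Z)) <= ln K - pi * q v.
  by rewrite -lnt -lnM ?posrE // ler_ln ?posrE.
have lo2 : - (pi * q v) - ln 2 <= ln (ln (fine Z)).
  by rewrite -lnt -ln_div ?posrE // ler_ln ?posrE // divr_gt0.
rewrite lnM ?posrE ?divr_gt0 // div1r lnV ?posrE // ler_norml.
have ln2 : 0 <= ln 2 :> R by rewrite ln_ge0 // ler1n.
have := ler_norm (ln w); have := ler_norm (ln K).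
have := ler_norm (- ln w); have := ler_norm (- ln K); rewrite !normrN.
by move=> *; apply/andP; split; lra.
Qed.

Lemma min_lengthE : injective (mink_emb S) -> mink_emb S 0 = 0 ->
  min_length (normsq D) (mink_emb S @` I) ^+ 2 = q v.
Proof.
move=> inj e0.
have sv : shortest_vector (normsq D) (mink_emb S @` I) (mink_emb S v).
  split; first by exists v.
    by rewrite -e0 (inj_eq inj).
  move=> _ [f If <-]; rewrite -e0 (inj_eq inj) => f0.
  by rewrite ler_sqrt ?q_ge0 //; exact: short.
rewrite /min_length; case: xgetP => [x _ [u [[f If <-] u0 hu] <-]|h]; last first.
  by case: (h (Num.sqrt (q v))); exists (mink_emb S v).
rewrite sqr_sqrtr ?q_ge0 //; apply/eqP; rewrite eq_le.
have f0 : f != 0 by move: u0; rewrite -{1}e0 (inj_eq inj).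
have [Lv nv _] := sv; have := hu _ Lv nv.
by rewrite ler_sqrt ?q_ge0 // => ->; exact: short.
Qed.
End Shortest.
End GaussianSum.

(** * The bound *)

(** The point is that the roots of unity are finite in number, since [fset_set] of an infinite set
    would have cardinality 0. For the zero divisor they are integral elements with [q] equal to the
    degree, so [finite_bounded] applies. *)
Lemma num_roots_unity_gt0 (R : realType) (F : fieldExtType rat) (S : infinite_primes R F) :
  (0 < num_roots_unity F)%N.
Proof.
have [n [dimF [b basis_b integral_b]]] := exists_integral_basis F.
have [d d_gt0 sub_d] := ringF_denominator basis_b integral_b.
pose D : arakelov_divisor S := ArakelovDivisor [fsfun] (fun=> 0) (fun=> 0).
have fin0 : finsupp (coef_fin D) = fset0 by exact: finsupp0.
have I0 : aideal D = @ringF F by rewrite /aideal fin0 big_nil.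
have deg0 : adeg D <= 0.
  by rewrite /adeg fin0 big_nil !big1 ?addr0.
have lambda0 : 0 < (d ^ (n.+1 + n.+1))%:R^-1 :> R by rewrite invr_gt0 ltr0n expn_gt0 d_gt0.
have low f : ringF f -> f != 0 -> (d ^ (n.+1 + n.+1))%:R^-1 ^+ 2 <= normsq D (mink_emb S f).
  by rewrite -I0; exact: (q_lower basis_b integral_b d_gt0 sub_d deg0).
have fin := finite_bounded (frac_ideal_ringF F).1 lambda0 low n.+1%:R.
have unity_fin : finite_set [set z : F | exists m, z ^+ m.+1 = 1].
  apply: sub_finite_set fin => z [m zm]; split.
    apply/ring_intP; exists ('X^(m.+1) - 1); first exact: monicXnsubC.
    by rewrite rmorphB /= map_polyXn rmorph1; apply/rootP; rewrite !hornerE zm subrr.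
  rewrite normsqE (eq_bigr (fun=> 1)) => [|t _].
    by rewrite sumr_const (card_places S basis_b).
  have -> : weight D t = 1 by case: t => [i|[j|j]] /=; rewrite ?mulr0 ?oppr0 expR0.
  have n1 : normc (1 : R[i]) = 1 by rewrite /normc /= expr0n /= addr0 expr1n sqrtr1.
  have normcX x k : normc (x ^+ k : R[i]) = normc x ^+ k.
    by elim: k => [|k IH]; rewrite ?expr0 // !exprS complex.ComplexField.Normc.normcM IH.
  have n0 : 0 <= normc (tau t z) by case: (tau t z) => x y; exact: sqrtr_ge0.
  have := normcX (tau t z) m.+1; rewrite -rmorphXn zm rmorph1 n1 => /esym/eqP.
  by rewrite pexpr_eq1 // => /eqP ->; rewrite expr1n mulr1.
rewrite /num_roots_unity cardfs_gt0; apply/fset0Pn; exists 1.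
by rewrite in_fset_set // inE; exists 0%N; rewrite expr1.
Qed.

Theorem corollary2 (R : realType) (F : fieldExtType rat) :
  exists beta : R,
  forall (S : infinite_primes R F) (D : arakelov_divisor S),
    let n := \dim {:F} in
    let w : R := (num_roots_unity F)%:R in
    let q := normsq D in
    let I := alattice D in
    adeg D < 0 ->
    `| ln (1 / w * h0 D) / covol q I `^ (2 / n%:R) + pi * hermite q I n |
      < beta * expR (2 * adeg D / n%:R).
Proof.
have [n [dimF [b basis_b integral_b]]] := exists_integral_basis F.
have [d d_gt0 sub_d] := ringF_denominator basis_b integral_b.
pose lambda0 : R := (d ^ (n.+1 + n.+1))%:R^-1.
have lambda0_gt0 : 0 < lambda0 by rewrite invr_gt0 ltr0n expn_gt0 d_gt0.
pose w : R := (num_roots_unity F)%:R.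
(* The packing constant depends on the places only through their number, so it is taken over
   ['I_n.+1], before [S] is introduced. *)
pose K : R := expR (pi * lambda0 ^+ 2) * packing_const 'I_n.+1 (pi * lambda0 ^+ 2).
pose C1 := `|ln w| + `|ln K| + ln 2.
pose C2 : R := Num.sqrt (ratr `|\det (trace_mx b)|) * lambda0.
have C2_gt0 : 0 < C2.
  by rewrite mulr_gt0 // sqrtr_gt0 ltr0q normr_gt0; exact: det_trace_mx.
have C1_ge0 : 0 <= C1 by rewrite !addr_ge0 // ln_ge0 // ler1n.
(* [C1] bounds the numerator and [C2 e^(-deg)] bounds the covolume from below; the added [1] makes
   the inequality strict. *)
exists (C1 / C2 `^ (2 / n.+1%:R) + 1) => S D N w' q I degD.
rewrite {}/N {}/w' dimF -/w; set p := 2 / n.+1%:R.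
have p_gt0 : 0 < p by rewrite divr_gt0.
have w_gt0 : 0 < w by rewrite ltr0n (num_roots_unity_gt0 S).
(* If [covol] takes the value 0, then both quotients vanish, because [0] to the positive power [p]
   is [0] and so is its inverse; the claim becomes [0 < beta e^(2 deg / n)]. *)
have [cv0|cv0] := eqVneq (covol q I) 0.
  rewrite /hermite cv0 powR0 ?gt_eqF // invr0 !mulr0 addr0 normr0 mulr_gt0 ?expR_gt0 //.
  by rewrite ltr_wpDl // divr_ge0 // powR_ge0.
have deg0 := ltW degD.
have iI := aideal_invertible basis_b integral_b D.
have [a a0 Ia] := invertible_nonzero iI.
have low f : aideal D f -> f != 0 -> lambda0 ^+ 2 <= normsq D (mink_emb S f).
  exact: (q_lower basis_b integral_b d_gt0 sub_d deg0).
have sI : subgroup (aideal D) by exact: iI.1.1.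
have [v [Iv v0 short]] := shortest_exists sI lambda0_gt0 low Ia a0.
have := log_theta_bound sI lambda0_gt0 low Iv v0 short w_gt0.
have -> : gauss_const S lambda0 = K.
  rewrite /gauss_const /K; congr (_ * _); apply: packing_const_card.
  by rewrite (card_places S basis_b) card_ord.
rewrite -/C1 => hlog.
have cv := covol_lower basis_b integral_b d_gt0 sub_d cv0.
have minl : min_length q I ^+ 2 = normsq D (mink_emb S v).
  apply: min_lengthE => //; first exact: (mink_emb_inj basis_b).
  by apply/eqP; rewrite (mink_emb_eq0 basis_b).
have cvp : C2 `^ p * expR (- (2 * adeg D / n.+1%:R)) <= covol q I `^ p.
  have -> : expR (- (2 * adeg D / n.+1%:R)) = expR (- adeg D) `^ p.
    by rewrite -expRM /p; congr expR; field; rewrite addrC natr1 pnatr_eq0.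
  rewrite -powRM ?expR_ge0 //; last exact: ltW.
  have x0 : 0 <= C2 * expR (- adeg D) by rewrite mulr_ge0 ?expR_ge0 // ltW.
  have h := @ge0_ler_powR R p (ltW p_gt0) (C2 * expR (- adeg D)) (covol q I).
  by apply: h; rewrite ?nnegrE //; exact: le_trans cv.
have C2p : 0 < C2 `^ p by rewrite powR_gt0.
have cvp_gt0 : 0 < covol q I `^ p.
  by apply: lt_le_trans cvp; rewrite mulr_gt0 ?expR_gt0.
rewrite /hermite minl mulrA -mulrDl normrM normfV (gtr0_norm cvp_gt0).
rewrite ltr_pdivrMr //; apply: le_lt_trans hlog _.
apply: lt_le_trans (_ : _ < (C1 / C2 `^ p + 1) * expR (2 * adeg D / n.+1%:R) *
  (C2 `^ p * expR (- (2 * adeg D / n.+1%:R)))) _; last first.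
  by rewrite ler_pM2l // mulr_gt0 ?expR_gt0 // ltr_wpDl // divr_ge0 // ltW.
rewrite mulrACA -expRD subrr expR0 mulr1 mulrDl divfK ?gt_eqF // mul1r.
by rewrite ltrDl.
Qed.
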